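(* Let $0\le\alpha<1$. (a) The function $v_\nu$ is convex of order $\alpha$ in the unit disk $\mathbb{D}$ if and only if $\nu\ge\nu_\alpha^c(v_\nu)$, where $\nu_\alpha^c(v_\nu)$ is the unique positive root of the equation (in $\nu$) $v_\nu''(1)+(1-\alpha)v_\nu'(1)=0$. (b) The function $w_\nu$ is convex of order $\alpha$ in $\mathbb{D}$ if and only if $\nu\ge\nu_\alpha^c(w_\nu)$, where $\nu_\alpha^c(w_\nu)$ is the unique root of the equation (in $\nu$) $w_\nu''(1)+(1-\alpha)w_\nu'(1)=0$.
   Context: For $\nu>-1$, with $J_\nu,I_\nu$ the Bessel and modified Bessel functions of the first kind and $\mathbf{\Pi}_\nu(z)=J_\nu(z)I_\nu(z)$, the normalized functions are defined by $$v_\nu(z)=2^{2\nu}z^{-2\nu+1}\Gamma^2(\nu+1)\mathbf{\Pi}_\nu(z)=\sum_{n\ge0}\frac{(-1)^n z^{4n+1}}{2^{4n}n!\,(\nu+1)_n(\nu+1)_{2n}},$$ $$w_\nu(z)=2^{2\nu}z^{-\frac{\nu}{2}+1}\Gamma^2(\nu+1)\mathbf{\Pi}_\nu(\sqrt[4]{z})=\sum_{n\ge0}\frac{(-1)^n z^{n+1}}{2^{4n}n!\,(\nu+1)_n(\nu+1)_{2n}},$$ where $(a)_0=1$, $(a)_n=a(a+1)\cdots(a+n-1)$; primes denote derivatives in $z$. $\mathbb{D}$ is the open unit disk. A function $f$ analytic in $\mathbb{D}$ with $f(0)=f'(0)-1=0$ is convex of order $\alpha$ in $\mathbb{D}$ if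 it is univalent and $\operatorname{Re}(1+zf''(z)/f'(z))>\alpha$ for all $z\in\mathbb{D}$.
   Formalization: In (a), ''unique positive root'' is replaced by ''unique root in ν > −1'': for α = 0 the left side of the equation at ν = 0 is about 0.222 > 0 and it increases with ν, so no positive root exists; positivity of the root is not claimed for any α. *)

(* Defs.v *)
From Stdlib Require Import Reals Factorial.
From Coquelicot Require Import Coquelicot.
Open Scope R_scope.

(* Sum of a series of complex numbers; it agrees with [is_series] in [C]
   whenever the series converges (lemma [CSeries_unique]). *)
Definition CSeries (a : nat -> C) : C :=
  (Series (fun n => Re (a n)), Series (fun n => Im (a n))).

Lemma CSeries_unique (a : nat -> C) (l : C) :
  is_series (K := C_AbsRing) (V := C_NormedModule) a l -> CSeries a = l.
Proof.
  intros H.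
  assert (Hfst : forall n, fst (sum_n (G := C_AbelianGroup) a n)
                           = sum_n (fun k => Re (a k)) n).
  { induction n as [|n IH]; [now rewrite !sum_O|].
    rewrite !sum_Sn, <- IH; reflexivity. }
  assert (Hsnd : forall n, snd (sum_n (G := C_AbelianGroup) a n)
                           = sum_n (fun k => Im (a k)) n).
  { induction n as [|n IH]; [now rewrite !sum_O|].
    rewrite !sum_Sn, <- IH; reflexivity. }
  unfold CSeries; destruct l as [x y]; f_equal; apply is_series_unique;
    intros P [eps HP].
  - destruct (H (ball (x, y) eps) (locally_ball _ _)) as [N HN].
    exists N; intros n Hn; apply HP.
    change (ball x eps (sum_n (fun k => Re (a k)) n)).
    rewrite <- Hfst; exact (proj1 (HN n Hn)).
  - destruct (H (ball (x, y) eps) (locally_ball _ _)) as [N HN].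
    exists N; intros n Hn; apply HP.
    change (ball y eps (sum_n (fun k => Im (a k)) n)).
    rewrite <- Hsnd; exact (proj2 (HN n Hn)).
Qed.

(* (a)_n = a (a + 1) ... (a + n - 1) *)
Fixpoint pochhammer (a : R) (n : nat) : R :=
  match n with
  | O => 1
  | S m => pochhammer a m * (a + INR m)
  end.

Definition besselProd_coeff (nu : R) (n : nat) : R :=
  (-1) ^ n / (2 ^ (4 * n) * INR (fact n)
              * pochhammer (nu + 1) n * pochhammer (nu + 1) (2 * n)).

(* 2^(2 nu) z^(1 - 2 nu) Gamma(nu + 1)^2 J_nu(z) I_nu(z), given by its series:
   the branches of the powers cancel, and the value at z = 0 is included. *)
Definition v (nu : R) (z : C) : C :=
  CSeries (fun n => (besselProd_coeff nu n * z ^ (4 * n + 1))%C).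

(* 2^(2 nu) z^(1 - nu / 2) Gamma(nu + 1)^2 J_nu(z^(1/4)) I_nu(z^(1/4)),
   given by its series. *)
Definition w (nu : R) (z : C) : C :=
  CSeries (fun n => (besselProd_coeff nu n * z ^ (n + 1))%C).

Definition in_disk (z : C) : Prop := Cmod z < 1.

Definition analytic_on_disk (f : C -> C) : Prop :=
  forall z, in_disk z ->
    ex_derive (K := C_AbsRing) (V := C_NormedModule) f z.

Definition univalent_on_disk (f : C -> C) : Prop :=
  forall z1 z2, in_disk z1 -> in_disk z2 -> f z1 = f z2 -> z1 = z2.

(* Univalence forces f' to be nonzero on the disk, so the totalized division
   is never a division by zero for a function satisfying this predicate. *)
Definition convex_of_order (alpha : R) (f : C -> C) : Prop :=
  analytic_on_disk f /\ f 0 = 0%C /\ C_derive f 0 = 1%C /\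
  univalent_on_disk f /\
  forall z, in_disk z ->
    alpha < Re (1 + z * C_derive (C_derive f) z / C_derive f z)%C.

(* f''(1) + (1 - alpha) f'(1) = 0, with complex derivatives. *)
Definition convexity_equation (alpha : R) (f : C -> C) : Prop :=
  (C_derive (C_derive f) 1 + (1 - alpha) * C_derive f 1)%C = 0%C.

(* Main.v *)
Require Import Defs.
From Stdlib Require Import Reals Factorial Lra Lia FunctionalExtensionality.
From Coquelicot Require Import Coquelicot.
Open Scope R_scope.

(** Write c_n for the coefficients [besselProd_coeff nu n] and let
    f(z) = sum_n c_n z^(k n + 1) ([lacunary k nu]): the two functions of the
    theorem are the cases k = 4 and k = 1. With zeta = z^k and lam = 1 - alpha,
    the functions f'(z), z f''(z) and z f''(z) + lam f'(z) are power series
    A, B and h = B + lam A in zeta. Convexity of order alpha says that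
    Re (h / A) > 0 on the disk, and the equation in nu says that h(1) = 0
    ([convexity_equation_iff]).

    The zeros of f' never enter. What carries the proof is that, for every
    nu > -1, the c_n shrink by a factor of at least 192 from n = 1 on
    ([coeff_decay]). Hence the coefficients of A, B and h of degree at least 2,
    even weighted by n^2, add up to at most 1/11 of the linear coefficient. By
    [dominated_lead_term] this still holds when the powers are replaced by
    any quantities d_n with |d_n| <= n^2 |d_1|; such are the increments
    1 - Re zeta^n, the imaginary parts of zeta^n, and the relative variations
    of c_n with nu. Each of these series therefore behaves like its linear
    term, whose coefficient is negative.

    If h(1) >= 0: replacing 1 by zeta increases Re h, so Re h(zeta) > 0; the
    imaginary parts of h(zeta) and A(zeta) have the same sign, opposite to
    that of Im zeta; and Re A(zeta) > 0, because h(1) >= 0 bounds the linear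
    coefficient of A by 11/20. So the real part of h times the conjugate of A
    is positive ([convexity_on_disk]). The same bound gives univalence
    ([lacunary_univalent]). If h(1) < 0: since h(0) = lam > 0, h vanishes
    somewhere in (0, 1), where B < 0; there A = - B / lam > 0, and
    1 + z f'' / f' equals alpha exactly ([lacunary_convex_necessary]).

    It remains to see that h(1), as a function of nu, vanishes exactly once on
    (-1, +oo). A change of nu changes h(1) by the change of its linear
    coefficient, up to a factor between 10/11 and 12/11 ([convValue_diff]).
    So h(1) is increasing and continuous, and it takes both signs
    ([convValue_root]). *)

(** * Series dominated by their linear term *)

Lemma INR_S_ge_1 (n : nat) : 1 <= INR (S n).
Proof. rewrite S_INR. generalize (pos_INR n); lra. Qed.

Lemma INR_S_le_sq (n : nat) (D : R) : 0 <= D -> INR (S n) * D <= INR (S n) ^ 2 * D.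
Proof.
  intros HD. apply Rmult_le_compat_r; [exact HD|].
  generalize (INR_S_ge_1 n); nra.
Qed.

Lemma le_INR_S_sq (n : nat) (D : R) : 0 <= D -> D <= INR (S n) ^ 2 * D.
Proof.
  intros HD. rewrite <- (Rmult_1_l D) at 1.
  apply Rmult_le_compat_r; [exact HD|]. generalize (INR_S_ge_1 n); nra.
Qed.

(** The weight n^2 leaves room for multipliers of quadratic growth, such as
    1 - Re z^n compared with 1 - Re z. *)
Definition dominated (t : nat -> R) : Prop :=
  forall n, INR (S n) ^ 2 * Rabs (t (S n)) <= Rabs (t 1%nat) * (1 / 12) ^ n.

Lemma dominated_term_bound (t d : nat -> R) (D : R) :
  dominated t -> (forall n, Rabs (d (S n)) <= INR (S n) ^ 2 * D) ->
  forall n, Rabs (t (S n) * d (S n)) <= Rabs (t 1%nat) * D * (1 / 12) ^ n.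
Proof.
  intros Ht Hd n. rewrite Rabs_mult.
  apply Rle_trans with (Rabs (t (S n)) * (INR (S n) ^ 2 * D)).
  - apply Rmult_le_compat_l; [apply Rabs_pos | apply Hd].
  - assert (HD : 0 <= D).
    { generalize (Hd 0%nat) (Rabs_pos (d 1%nat)); simpl; nra. }
    generalize (Rmult_le_compat_r D _ _ HD (Ht n)). lra.
Qed.

Lemma ex_series_geom_bound (a : nat -> R) (M q : R) :
  0 <= q < 1 -> (forall n, Rabs (a n) <= M * q ^ n) ->
  ex_series (fun n => Rabs (a n)).
Proof.
  intros Hq Ha.
  apply (@ex_series_le R_AbsRing R_CompleteNormedModule)
    with (b := fun n => M * q ^ n).
  - intros n. change (Rabs (Rabs (a n)) <= M * q ^ n).
    rewrite Rabs_Rabsolu. apply Ha.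
  - apply (@ex_series_scal R_AbsRing R_NormedModule).
    apply ex_series_geom. rewrite Rabs_pos_eq; lra.
Qed.

Lemma Series_abs_geom_bound (a : nat -> R) (M q : R) :
  0 <= q < 1 -> (forall n, Rabs (a n) <= M * q ^ n) ->
  Rabs (Series a) <= M / (1 - q).
Proof.
  intros Hq Ha.
  apply Rle_trans with (1 := Series_Rabs _ (ex_series_geom_bound a M q Hq Ha)).
  replace (M / (1 - q)) with (Series (fun n => M * q ^ n)).
  - apply Series_le.
    + intros n; split; [apply Rabs_pos | apply Ha].
    + apply (@ex_series_scal R_AbsRing R_NormedModule).
      apply ex_series_geom. rewrite Rabs_pos_eq; lra.
  - rewrite Series_scal_l, Series_geom; [reflexivity|].
    rewrite Rabs_pos_eq; lra.
Qed.

Lemma dominated_ex_series (t d : nat -> R) (D : R) :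
  dominated t -> (forall n, Rabs (d (S n)) <= INR (S n) ^ 2 * D) ->
  ex_series (fun n => t n * d n).
Proof.
  intros Ht Hd. apply ex_series_Rabs.
  apply (ex_series_incr_1 (fun n => Rabs (t n * d n))).
  apply (ex_series_geom_bound (fun n => t (S n) * d (S n))
           (Rabs (t 1%nat) * D) (1 / 12)); [lra|].
  now apply dominated_term_bound.
Qed.

(** The terms of index at least 2 are bounded by a geometric series of ratio
    1/12, whose sum is 1/11 of the bound at index 1. *)
Lemma dominated_lead_term (t d : nat -> R) (D : R) :
  dominated t -> (forall n, Rabs (d (S n)) <= INR (S n) ^ 2 * D) ->
  Rabs (Series (fun n => t n * d n) - t 0%nat * d 0%nat - t 1%nat * d 1%nat)
  <= Rabs (t 1%nat) * D / 11.
Proof.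
  intros Ht Hd.
  assert (Hex := dominated_ex_series t d D Ht Hd).
  rewrite (Series_incr_1 _ Hex).
  rewrite Series_incr_1 by now apply (ex_series_incr_1 (fun n => t n * d n)).
  replace (_ - _ - _) with (Series (fun n => t (S (S n)) * d (S (S n)))) by ring.
  replace (_ / 11) with (Rabs (t 1%nat) * D * (1 / 12) / (1 - 1 / 12)) by field.
  apply Series_abs_geom_bound; [lra|].
  intros n.
  apply Rle_trans with (1 := dominated_term_bound t d D Ht Hd (S n)).
  simpl; lra.
Qed.

Lemma dominated_ex (t : nat -> R) : dominated t -> ex_series t.
Proof.
  intros Ht. apply (ex_series_ext (fun n => t n * 1)); [intros n; apply Rmult_1_r|].
  apply dominated_ex_series with 1; [exact Ht|].
  intros n. rewrite Rabs_R1. apply le_INR_S_sq; lra.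
Qed.

Lemma dominated_Series (t : nat -> R) :
  dominated t -> Rabs (Series t - t 0%nat - t 1%nat) <= Rabs (t 1%nat) / 11.
Proof.
  intros Ht.
  assert (H1 : forall n, Rabs 1 <= INR (S n) ^ 2 * 1).
  { intros n. rewrite Rabs_R1. apply le_INR_S_sq; lra. }
  assert (H := dominated_lead_term t (fun _ => 1) 1 Ht H1). cbv beta in H.
  rewrite (Series_ext (fun n => t n * 1) t) in H by (intros; ring).
  now rewrite !Rmult_1_r in H.
Qed.

Lemma dominated_Series_at_0 (t : nat -> R) :
  dominated t -> Series (fun n => t n * 0 ^ n) = t 0%nat.
Proof.
  intros Ht.
  assert (H0 : forall n, Rabs (0 ^ S n) <= INR (S n) ^ 2 * 0).
  { intros n. rewrite pow_i by lia. rewrite Rabs_R0. lra. }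
  assert (H := dominated_lead_term t (fun n => 0 ^ n) 0 Ht H0).
  cbv beta in H. rewrite pow_O, pow_1 in H. apply Rabs_le_between in H. lra.
Qed.

(** * Termwise differentiation of complex power series *)

Lemma CSeries_ext (a b : nat -> C) :
  (forall n, a n = b n) -> CSeries a = CSeries b.
Proof.
  intros H; unfold CSeries; f_equal; apply Series_ext; intros n; now rewrite H.
Qed.

Lemma im_le_Cmod (z : C) : Rabs (Im z) <= Cmod z.
Proof.
  apply Rle_trans with (2 := Rmax_Cmod z). apply Rmax_r.
Qed.

Lemma ex_series_Re (a : nat -> C) :
  ex_series (fun n => Cmod (a n)) -> ex_series (fun n => Re (a n)).
Proof.
  intros H.
  apply (@ex_series_le R_AbsRing R_CompleteNormedModule) with (2 := H).
  intros n; apply re_le_Cmod.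
Qed.

Lemma ex_series_Im (a : nat -> C) :
  ex_series (fun n => Cmod (a n)) -> ex_series (fun n => Im (a n)).
Proof.
  intros H.
  apply (@ex_series_le R_AbsRing R_CompleteNormedModule) with (2 := H).
  intros n; apply im_le_Cmod.
Qed.

Lemma ex_series_Cmod_minus (a b : nat -> C) :
  ex_series (fun n => Cmod (a n)) -> ex_series (fun n => Cmod (b n)) ->
  ex_series (fun n => Cmod (a n - b n)%C).
Proof.
  intros Ha Hb.
  apply (@ex_series_le R_AbsRing R_CompleteNormedModule)
    with (b := fun n => Cmod (a n) + Cmod (b n)).
  - intros n. change (Rabs (Cmod (a n - b n)%C) <= Cmod (a n) + Cmod (b n)).
    rewrite Rabs_pos_eq by apply Cmod_ge_0.
    apply Rle_trans with (1 := Cmod_triangle _ _). rewrite Cmod_opp; lra.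
  - now apply (@ex_series_plus R_AbsRing R_NormedModule).
Qed.

Lemma CSeries_minus (a b : nat -> C) :
  ex_series (fun n => Cmod (a n)) -> ex_series (fun n => Cmod (b n)) ->
  CSeries (fun n => (a n - b n)%C) = (CSeries a - CSeries b)%C.
Proof.
  intros Ha Hb. unfold CSeries, Cminus, Cplus, Copp; simpl. f_equal.
  - apply (Series_minus (fun n => Re (a n)) (fun n => Re (b n)));
      now apply ex_series_Re.
  - apply (Series_minus (fun n => Im (a n)) (fun n => Im (b n)));
      now apply ex_series_Im.
Qed.

Lemma CSeries_scal (c : C) (a : nat -> C) :
  ex_series (fun n => Cmod (a n)) ->
  CSeries (fun n => (c * a n)%C) = (c * CSeries a)%C.
Proof.
  intros Ha. unfold CSeries, Cmult; simpl.
  rewrite <- !Series_scal_l.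
  f_equal.
  - rewrite <- Series_minus; [reflexivity| |];
      apply (@ex_series_scal R_AbsRing R_NormedModule);
      [now apply ex_series_Re | now apply ex_series_Im].
  - rewrite <- Series_plus; [reflexivity| |];
      apply (@ex_series_scal R_AbsRing R_NormedModule);
      [now apply ex_series_Im | now apply ex_series_Re].
Qed.

(** The real and imaginary series are bounded separately, whence the factor 2. *)
Lemma Cmod_CSeries_le (a : nat -> C) (b : nat -> R) :
  (forall n, Cmod (a n) <= b n) -> ex_series b ->
  Cmod (CSeries a) <= 2 * Series b.
Proof.
  intros Hab Hb.
  assert (H1 : forall g : nat -> R, (forall n, Rabs (g n) <= Cmod (a n)) ->
                 Rabs (Series g) <= Series b).
  { intros g Hg. apply Rle_trans with (Series (fun n => Rabs (g n))).
    - apply Series_Rabs.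
      apply (@ex_series_le R_AbsRing R_CompleteNormedModule) with (2 := Hb).
      intros n. change (Rabs (Rabs (g n)) <= b n). rewrite Rabs_Rabsolu.
      apply Rle_trans with (1 := Hg n); apply Hab.
    - apply Series_le; [|exact Hb].
      intros n; split; [apply Rabs_pos|].
      apply Rle_trans with (1 := Hg n); apply Hab. }
  assert (HR := H1 _ (fun n => re_le_Cmod (a n))).
  assert (HI := H1 _ (fun n => im_le_Cmod (a n))).
  replace (CSeries a)
    with (RtoC (Series (fun n => Re (a n))) + Ci * RtoC (Series (fun n => Im (a n))))%C
    by (unfold CSeries, Cplus, Cmult, Ci, RtoC; simpl; f_equal; ring).
  apply Rle_trans with (1 := Cmod_triangle _ _).
  rewrite Cmod_mult, Cmod_Ci, !Cmod_R. lra.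
Qed.

(** Arbitrary exponents, so that the derivative of such a sum is again one, and
    so that the sums in z^(k n + 1) and in z^n are treated alike. *)
Definition powSum (a : nat -> R) (m : nat -> nat) (z : C) : C :=
  CSeries (fun n => (a n * z ^ m n)%C).

(** The remainder e_m of order m satisfies
    e_(m+1) = (z + h) e_m + m z^(m-1) h^2. *)
Lemma Cpow_taylor2 (r : R) (z h : C) (m : nat) :
  1 <= r -> Cmod z <= r -> Cmod (z + h)%C <= r ->
  Cmod ((z + h) ^ m - z ^ m - INR m * z ^ pred m * h)%C
  <= INR m ^ 2 * r ^ m * Cmod h ^ 2.
Proof.
  intros Hr Hz Hzh. induction m as [|m IH].
  - simpl. replace (1 - 1 - 0 * 1 * h)%C with (RtoC 0) by ring.
    rewrite Cmod_0. lra.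
  - assert (Hid : ((z + h) ^ S m - z ^ S m - INR (S m) * z ^ pred (S m) * h
       = (z + h) * ((z + h) ^ m - z ^ m - INR m * z ^ pred m * h)
         + INR m * z ^ pred m * (h * h))%C).
    { destruct m as [|m]; [simpl; ring|].
      rewrite (S_INR (S m)), RtoC_plus. simpl pred. rewrite !Cpow_S. ring. }
    rewrite Hid. apply Rle_trans with (1 := Cmod_triangle _ _).
    rewrite !Cmod_mult, Cmod_R, Cmod_pow, (Rabs_pos_eq (INR m)) by apply pos_INR.
    assert (Hp : Cmod z ^ pred m <= r ^ S m).
    { apply Rle_trans with (r ^ pred m).
      - apply pow_incr; split; [apply Cmod_ge_0 | exact Hz].
      - apply Rle_pow; [exact Hr | lia]. }
    assert (Hrm : 0 <= r ^ m) by (apply pow_le; lra).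
    assert (H1 : Cmod (z + h) * Cmod ((z + h) ^ m - z ^ m - INR m * z ^ pred m * h)
       <= r * (INR m ^ 2 * r ^ m * Cmod h ^ 2)).
    { apply Rmult_le_compat; auto using Cmod_ge_0. }
    assert (Hm := pos_INR m).
    assert (H2 : INR m * Cmod z ^ pred m * (Cmod h * Cmod h)
       <= INR m * r ^ S m * (Cmod h * Cmod h)).
    { apply Rmult_le_compat_r; [nra|]. now apply Rmult_le_compat_l. }
    rewrite S_INR. simpl pow in *.
    assert (H3 : 0 <= r * r ^ m * (Cmod h * Cmod h)) by (apply Rmult_le_pos; nra).
    nra.
Qed.

Definition summable (a : nat -> R) (m : nat -> nat) (r : R) : Prop :=
  ex_series (fun n => Rabs (a n) * (INR (m n) + 1) ^ 2 * r ^ m n).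

Lemma summable_bound (a : nat -> R) (m : nat -> nat) (r : R) (c : nat -> C) :
  summable a m r ->
  (forall n, Cmod (c n) <= Rabs (a n) * (INR (m n) + 1) ^ 2 * r ^ m n) ->
  ex_series (fun n => Cmod (c n)).
Proof.
  intros Ha Hc.
  apply (@ex_series_le R_AbsRing R_CompleteNormedModule) with (2 := Ha).
  intros n. change (Rabs (Cmod (c n)) <= Rabs (a n) * (INR (m n) + 1) ^ 2 * r ^ m n).
  rewrite Rabs_pos_eq by apply Cmod_ge_0. apply Hc.
Qed.

Lemma powSum_ex (a : nat -> R) (m : nat -> nat) (r : R) (z : C) :
  1 <= r -> summable a m r -> Cmod z <= r ->
  ex_series (fun n => Cmod (a n * z ^ m n)%C).
Proof.
  intros Hr Ha Hz. apply (summable_bound a m r _ Ha). intros n.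
  rewrite Cmod_mult, Cmod_pow, Cmod_R.
  assert (Hp : Cmod z ^ m n <= r ^ m n)
    by (apply pow_incr; split; [apply Cmod_ge_0 | exact Hz]).
  assert (Hp0 : 0 <= Cmod z ^ m n) by (apply pow_le, Cmod_ge_0).
  assert (Hm := pos_INR (m n)). assert (Hn := Rabs_pos (a n)).
  rewrite Rmult_assoc. apply Rmult_le_compat_l; [exact Hn|]. nra.
Qed.

Lemma powSum_ex_derive (a : nat -> R) (m : nat -> nat) (r : R) (z : C) :
  1 <= r -> summable a m r -> Cmod z <= r ->
  ex_series (fun n => Cmod ((a n * INR (m n))%R * z ^ pred (m n))%C).
Proof.
  intros Hr Ha Hz. apply (summable_bound a m r _ Ha). intros n.
  rewrite Cmod_mult, Cmod_pow, Cmod_R, Rabs_mult.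
  assert (Hp : Cmod z ^ pred (m n) <= r ^ m n).
  { apply Rle_trans with (r ^ pred (m n)).
    - apply pow_incr; split; [apply Cmod_ge_0 | exact Hz].
    - apply Rle_pow; [exact Hr | lia]. }
  assert (Hp0 : 0 <= Cmod z ^ pred (m n)) by (apply pow_le, Cmod_ge_0).
  assert (Hm := pos_INR (m n)). assert (Hn := Rabs_pos (a n)).
  rewrite (Rabs_pos_eq _ Hm), !Rmult_assoc.
  apply Rmult_le_compat_l; [exact Hn|]. nra.
Qed.

(** Summing the second-order remainders of the powers gives a remainder that is
    O(|y - z|^2) for y near z. *)
Lemma powSum_is_derive (a : nat -> R) (m : nat -> nat) (r : R) (z : C) :
  1 <= r -> summable a m r -> Cmod z < r ->
  is_derive (K := C_AbsRing) (V := C_NormedModule) (powSum a m) z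
    (powSum (fun n => a n * INR (m n)) (fun n => pred (m n)) z).
Proof.
  intros Hr Ha Hz.
  set (l := powSum (fun n => a n * INR (m n)) (fun n => pred (m n)) z).
  set (M := Series (fun n => Rabs (a n) * (INR (m n) + 1) ^ 2 * r ^ m n)).
  assert (HM : 0 <= M).
  { replace 0 with (Series (fun _ => 0 * 0)) by (rewrite Series_scal_l; ring).
    apply Series_le; [|exact Ha]. intros n; split; [lra|]. rewrite Rmult_0_l.
    apply Rmult_le_pos; [|apply pow_le; lra].
    apply Rmult_le_pos; [apply Rabs_pos | apply pow2_ge_0]. }
  assert (Hquad : forall y : C, Cmod (y - z)%C < r - Cmod z ->
     Cmod (powSum a m y - powSum a m z - (y - z) * l)%C <= 2 * M * Cmod (y - z)%C ^ 2).
  { intros y Hy. set (h := (y - z)%C) in *.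
    assert (Hyz : y = (z + h)%C) by (unfold h; ring).
    assert (Hyr : Cmod y <= r).
    { rewrite Hyz. apply Rle_trans with (1 := Cmod_triangle _ _). lra. }
    unfold powSum, l.
    rewrite <- CSeries_minus by (apply powSum_ex with r; auto; lra).
    unfold powSum. rewrite <- CSeries_scal
      by (apply powSum_ex_derive with (r := r); auto; lra).
    rewrite <- CSeries_minus.
    - rewrite Rmult_assoc. unfold M. rewrite <- Series_scal_r.
      apply Cmod_CSeries_le.
      + intros n.
        replace (a n * y ^ m n - a n * z ^ m n
                 - h * ((a n * INR (m n))%R * z ^ pred (m n)))%C
          with (a n * ((z + h) ^ m n - z ^ m n - INR (m n) * z ^ pred (m n) * h))%C
          by (rewrite Hyz, RtoC_mult; ring).
        rewrite Cmod_mult, Cmod_R, !Rmult_assoc.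
        apply Rmult_le_compat_l; [apply Rabs_pos|].
        rewrite Hyz in Hyr.
        apply Rle_trans with (1 := Cpow_taylor2 r z h (m n) Hr (Rlt_le _ _ Hz) Hyr).
        assert (Hm := pos_INR (m n)).
        assert (0 <= r ^ m n * Cmod h ^ 2)
          by (apply Rmult_le_pos; [apply pow_le; lra | apply pow2_ge_0]).
        nra.
      + apply ex_series_scal_r, Ha.
    - apply ex_series_Cmod_minus; apply powSum_ex with r; auto; lra.
    - assert (Hs := powSum_ex_derive a m r z Hr Ha (Rlt_le _ _ Hz)).
      apply (@ex_series_scal_l R_AbsRing) with (c := Cmod h) in Hs.
      apply ex_series_ext with (2 := Hs). intros n. simpl.
      now rewrite (Cmod_mult h). }
  split.
  { apply (is_linear_scal_l (K := C_AbsRing) (V := C_NormedModule) l). }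
  intros x Hx.
  apply (is_filter_lim_locally_unique (V := AbsRing_NormedModule C_AbsRing)) in Hx.
  subst x. intros eps.
  assert (Hd : 0 < Rmin (r - Cmod z) (eps / (2 * M + 1))).
  { apply Rmin_pos; [lra|]. apply Rdiv_lt_0_compat; [apply cond_pos | lra]. }
  exists (mkposreal _ Hd). intros y Hy.
  change (Cmod (y - z)%C < Rmin (r - Cmod z) (eps / (2 * M + 1))) in Hy.
  change (Cmod (powSum a m y - powSum a m z - (y - z) * l)%C <= eps * Cmod (y - z)%C).
  apply Rle_trans with (1 := Hquad y (Rlt_le_trans _ _ _ Hy (Rmin_l _ _))).
  assert (Hy2 := Rlt_le_trans _ _ _ Hy (Rmin_r _ _)).
  assert (H0 := Cmod_ge_0 (y - z)%C).
  assert (H1 : (2 * M + 1) * Cmod (y - z)%C <= eps).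
  { apply Rmult_lt_compat_l with (r := 2 * M + 1) in Hy2; [|lra].
    replace ((2 * M + 1) * (eps / (2 * M + 1))) with (pos eps) in Hy2 by (field; lra).
    lra. }
  simpl. nra.
Qed.

(** * The coefficients and the derivatives of the lacunary series *)

Lemma pochhammer_pos (a : R) (n : nat) : 0 < a -> 0 < pochhammer a n.
Proof.
  intros Ha; induction n as [|n IH]; simpl; [lra|].
  apply Rmult_lt_0_compat; [exact IH|]. generalize (pos_INR n); lra.
Qed.

(** The quotient - c_n / c_(n+1), by [coeff_S]. *)
Definition coeff_ratio (nu : R) (n : nat) : R :=
  16 * INR (S n) * (nu + 1 + INR n) * (nu + 1 + INR (2 * n))
  * (nu + 1 + INR (S (2 * n))).

Lemma coeff_ratio_pos (nu : R) (n : nat) : -1 < nu -> 0 < coeff_ratio nu n.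
Proof.
  intros Hnu. unfold coeff_ratio.
  assert (H1 := pos_INR n). assert (H2 := pos_INR (2 * n)).
  rewrite (S_INR (2 * n)), (S_INR n).
  repeat apply Rmult_lt_0_compat; lra.
Qed.

Lemma coeff_0 (nu : R) : besselProd_coeff nu 0 = 1.
Proof. unfold besselProd_coeff; simpl; field. Qed.

Lemma coeff_S (nu : R) (n : nat) :
  -1 < nu ->
  besselProd_coeff nu (S n) = - besselProd_coeff nu n / coeff_ratio nu n.
Proof.
  intros Hnu. assert (Hr := coeff_ratio_pos nu n Hnu).
  unfold coeff_ratio in *.
  unfold besselProd_coeff.
  replace (2 * S n)%nat with (S (S (2 * n))) by lia.
  replace (4 * S n)%nat with (4 + 4 * n)%nat by lia.
  rewrite fact_simpl, mult_INR, pow_add.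
  change (pochhammer (nu + 1) (S (S (2 * n))))
    with (pochhammer (nu + 1) (2 * n) * (nu + 1 + INR (2 * n))
          * (nu + 1 + INR (S (2 * n)))).
  change (pochhammer (nu + 1) (S n)) with (pochhammer (nu + 1) n * (nu + 1 + INR n)).
  change ((-1) ^ S n) with (-1 * (-1) ^ n).
  assert (0 < pochhammer (nu + 1) n) by (apply pochhammer_pos; lra).
  assert (0 < pochhammer (nu + 1) (2 * n)) by (apply pochhammer_pos; lra).
  assert (0 < 2 ^ (4 * n)) by (apply pow_lt; lra).
  assert (0 < INR (fact n)) by apply INR_fact_lt_0.
  assert (0 < INR (S n)) by (rewrite S_INR; generalize (pos_INR n); lra).
  assert (Hn1 := pos_INR n). assert (Hn2 := pos_INR (2 * n)).
  assert (Hn3 := pos_INR (S (2 * n))).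
  field. repeat split; lra.
Qed.

Lemma coeff_1 (nu : R) :
  -1 < nu -> besselProd_coeff nu 1 = - / (16 * (nu + 1) ^ 2 * (nu + 2)).
Proof.
  intros Hnu. rewrite coeff_S, coeff_0 by exact Hnu.
  unfold coeff_ratio; simpl. field. lra.
Qed.

Lemma coeff_1_neg (nu : R) : -1 < nu -> besselProd_coeff nu 1 < 0.
Proof.
  intros Hnu. rewrite coeff_S, coeff_0 by exact Hnu.
  generalize (Rdiv_lt_0_compat 1 _ Rlt_0_1 (coeff_ratio_pos nu 0 Hnu)).
  unfold Rdiv; lra.
Qed.

Lemma coeff_neq_0 (nu : R) (n : nat) : -1 < nu -> besselProd_coeff nu n <> 0.
Proof.
  intros Hnu. induction n as [|n IH]; [rewrite coeff_0; lra|].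
  rewrite coeff_S by exact Hnu. assert (Hr := coeff_ratio_pos nu n Hnu).
  intros H0. apply IH.
  replace (besselProd_coeff nu n)
    with (- coeff_ratio nu n * (- besselProd_coeff nu n / coeff_ratio nu n))
    by (field; lra).
  rewrite H0; ring.
Qed.

(** At n = 1 the ratio is 32 (nu + 2) (nu + 3) (nu + 4) > 32 * 1 * 2 * 3, and it
    grows with n. *)
Lemma coeff_decay (nu : R) (n : nat) :
  -1 < nu ->
  192 * Rabs (besselProd_coeff nu (S (S n))) <= Rabs (besselProd_coeff nu (S n)).
Proof.
  intros Hnu. rewrite (coeff_S nu (S n)) by exact Hnu.
  assert (Hr : 192 <= coeff_ratio nu (S n)).
  { unfold coeff_ratio. rewrite (S_INR (2 * S n)), mult_INR, !S_INR.
    change (INR 0) with 0. assert (Hn := pos_INR n).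
    set (x := INR n) in *. set (a := nu + 1). assert (Ha : 0 < a) by (unfold a; lra).
    assert (H1 : 32 <= 16 * (x + 1 + 1)) by lra.
    assert (H2 : 32 <= 16 * (x + 1 + 1) * (a + (x + 1))) by nra.
    assert (H3 : 64 <= 16 * (x + 1 + 1) * (a + (x + 1)) * (a + (0 + 1 + 1) * (x + 1)))
      by nra.
    nra. }
  unfold Rdiv. rewrite Rabs_mult, Rabs_Ropp, Rabs_inv, (Rabs_pos_eq (coeff_ratio _ _)) by lra.
  assert (Hi : / coeff_ratio nu (S n) <= / 192) by (apply Rinv_le_contravar; lra).
  generalize (Rabs_pos (besselProd_coeff nu (S n))); nra.
Qed.

Lemma coeff_geom_bound (nu : R) (n : nat) :
  -1 < nu ->
  Rabs (besselProd_coeff nu (S n)) <= Rabs (besselProd_coeff nu 1) * (1 / 192) ^ n.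
Proof.
  intros Hnu. induction n as [|n IH]; [simpl; lra|].
  generalize (coeff_decay nu n Hnu). simpl pow. lra.
Qed.

(** A factor 4 per step for the weight and a factor 4 for n^2 against 1/192 for
    the coefficients leave the ratio 16/192 = 1/12 of [dominated]. *)
Definition slow_weight (g : nat -> R) : Prop :=
  (forall n, 0 <= g n) /\ forall n, g (S (S n)) <= 4 * g (S n).

Lemma coeff_dominated (nu : R) (g : nat -> R) :
  -1 < nu -> slow_weight g -> dominated (fun n => besselProd_coeff nu n * g n).
Proof.
  intros Hnu [Hg0 Hg] n. induction n as [|n IH]; [simpl; lra|].
  apply Rle_trans
    with (1 / 12 * (INR (S n) ^ 2 * Rabs (besselProd_coeff nu (S n) * g (S n))));
    [|simpl pow in *; lra].
  rewrite !Rabs_mult, !(Rabs_pos_eq (g _)) by auto.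
  assert (Hd := coeff_decay nu n Hnu).
  set (c2 := Rabs (besselProd_coeff nu (S (S n)))) in *.
  set (c1 := Rabs (besselProd_coeff nu (S n))) in *.
  assert (H2 : 0 <= c2) by apply Rabs_pos.
  assert (Hsq : INR (S (S n)) ^ 2 <= 4 * INR (S n) ^ 2).
  { rewrite !S_INR. generalize (pos_INR n); nra. }
  assert (Hcg : 192 * (c2 * g (S (S n))) <= c1 * (4 * g (S n))).
  { generalize (Rmult_le_compat _ _ _ _ (Rmult_le_pos 192 _ ltac:(lra) H2) (Hg0 _) Hd (Hg n)).
    lra. }
  assert (Hp : 0 <= c2 * g (S (S n))) by (apply Rmult_le_pos; auto).
  assert (Hs := pow2_ge_0 (INR (S n))).
  assert (Ha : INR (S (S n)) ^ 2 * (c2 * g (S (S n))) <= 4 * INR (S n) ^ 2 * (c2 * g (S (S n))))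
    by now apply Rmult_le_compat_r.
  assert (Hb : INR (S n) ^ 2 * (192 * (c2 * g (S (S n)))) <= INR (S n) ^ 2 * (c1 * (4 * g (S n))))
    by now apply Rmult_le_compat_l.
  lra.
Qed.

Definition affine_weight (k : nat) (lam : R) (n : nat) : R := INR k * INR n + lam.

Lemma affine_weight_pos (k n : nat) (lam : R) : 0 <= lam -> 0 <= affine_weight k lam n.
Proof.
  intros Hl. unfold affine_weight.
  generalize (Rmult_le_pos _ _ (pos_INR k) (pos_INR n)); lra.
Qed.

Lemma affine_weight_double (k n : nat) (lam : R) :
  0 <= lam -> affine_weight k lam (S (S n)) <= 2 * affine_weight k lam (S n).
Proof.
  intros Hl. unfold affine_weight. rewrite !S_INR.
  generalize (Rmult_le_pos _ _ (pos_INR k) (pos_INR n)) (pos_INR k); nra.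
Qed.

Definition deriv_weight (k : nat) : nat -> R := affine_weight k 1.

(** The coefficient of z^(k n) in z f'' + lam f' is (k n + 1) (k n + lam) c_n. *)
Definition conv_weight (k : nat) (lam : R) (n : nat) : R :=
  deriv_weight k n * affine_weight k lam n.

Lemma deriv_weight_slow (k : nat) : slow_weight (deriv_weight k).
Proof.
  split; intros n; [apply affine_weight_pos; lra|].
  generalize (affine_weight_double k n 1 ltac:(lra))
    (affine_weight_pos k (S n) 1 ltac:(lra)).
  unfold deriv_weight; lra.
Qed.

Lemma conv_weight_slow (k : nat) (lam : R) : 0 <= lam -> slow_weight (conv_weight k lam).
Proof.
  intros Hl. unfold conv_weight, deriv_weight. split; intros n.
  - apply Rmult_le_pos; apply affine_weight_pos; lra.
  - replace (4 * _)
      with ((2 * affine_weight k 1 (S n)) * (2 * affine_weight k lam (S n))) by ring.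
    apply Rmult_le_compat; try (apply affine_weight_pos; lra);
      apply affine_weight_double; lra.
Qed.

Definition lacunary (k : nat) (nu : R) : C -> C :=
  powSum (besselProd_coeff nu) (fun n => (k * n + 1)%nat).

Lemma cube_le_pow2 (m : nat) : INR m ^ 3 <= 4 * 2 ^ m.
Proof.
  (* The step (m + 1)^3 <= 2 m^3 holds from m = 4 on. *)
  do 4 (destruct m as [|m]; [simpl; lra|]).
  induction m as [|m IH]; [simpl; lra|].
  set (j := S (S (S (S m)))) in *.
  change (2 ^ S j) with (2 * 2 ^ j). rewrite S_INR.
  assert (Hj : 4 <= INR j).
  { unfold j. rewrite !S_INR. generalize (pos_INR m); lra. }
  nra.
Qed.

(** For k <= 4 the weight grows at most like 3^(4 n) = 81^n, which the decay
    192^(-n) of the coefficients absorbs. *)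
Lemma coeff_cubic_summable (nu : R) (k : nat) (g : nat -> R) :
  -1 < nu -> (k <= 4)%nat ->
  (forall n, 0 <= g n <= INR (k * n + 2) ^ 3 * (3 / 2) ^ (k * n + 1)) ->
  ex_series (fun n => Rabs (besselProd_coeff nu n) * g n).
Proof.
  intros Hnu Hk Hg.
  apply (ex_series_ext (fun n => Rabs (besselProd_coeff nu n * g n))).
  { intros n. rewrite Rabs_mult, (Rabs_pos_eq (g n)) by apply Hg. reflexivity. }
  apply (ex_series_incr_1 (fun n => Rabs (besselProd_coeff nu n * g n))).
  apply (ex_series_geom_bound (fun n => besselProd_coeff nu (S n) * g (S n))
           (Rabs (besselProd_coeff nu 1) * (8 * 243)) (81 / 192)); [lra|].
  intros n. rewrite Rabs_mult, (Rabs_pos_eq (g _)) by apply Hg.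
  replace (81 / 192) with (1 / 192 * 81) by field. rewrite Rpow_mult_distr.
  replace (_ * _ * (_ * _))
    with (Rabs (besselProd_coeff nu 1) * (1 / 192) ^ n * (8 * 243 * 81 ^ n)) by ring.
  apply Rmult_le_compat; [apply Rabs_pos | apply Hg | now apply coeff_geom_bound |].
  apply Rle_trans with (1 := proj2 (Hg (S n))).
  apply Rle_trans with (4 * 2 ^ (k * S n + 2) * (3 / 2) ^ (k * S n + 1)).
  { apply Rmult_le_compat_r; [apply pow_le; lra | apply cube_le_pow2]. }
  replace (k * S n + 2)%nat with (S (k * S n + 1)) by lia.
  change (2 ^ S (k * S n + 1)) with (2 * 2 ^ (k * S n + 1)).
  replace (4 * _ * _) with (8 * (2 ^ (k * S n + 1) * (3 / 2) ^ (k * S n + 1))) by ring.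
  rewrite <- Rpow_mult_distr. replace (2 * (3 / 2)) with 3 by field.
  rewrite Rmult_assoc. apply Rmult_le_compat_l; [lra|].
  replace (243 * 81 ^ n) with (3 ^ (5 + 4 * n)).
  - apply Rle_pow; [lra|]. nia.
  - rewrite pow_add, pow_mult.
    replace (3 ^ 5) with 243 by (simpl; ring). replace (3 ^ 4) with 81 by (simpl; ring).
    reflexivity.
Qed.

(** The radius 3/2 is used in order to differentiate twice at the boundary
    point 1. *)
Lemma lacunary_summable (nu : R) (k : nat) :
  -1 < nu -> (k <= 4)%nat ->
  summable (besselProd_coeff nu) (fun n => (k * n + 1)%nat) (3 / 2).
Proof.
  intros Hnu Hk.
  apply (ex_series_ext (fun n => Rabs (besselProd_coeff nu n)
     * ((INR (k * n + 1) + 1) ^ 2 * (3 / 2) ^ (k * n + 1)))).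
  { intros n. simpl; ring. }
  apply coeff_cubic_summable with k; auto. intros n.
  replace (k * n + 2)%nat with (S (k * n + 1)) by lia. rewrite (S_INR (k * n + 1)).
  assert (Hm := pos_INR (k * n + 1)).
  assert (Hp : 0 <= (3 / 2) ^ (k * n + 1)) by (apply pow_le; lra).
  split; [apply Rmult_le_pos; nra|]. apply Rmult_le_compat_r; nra.
Qed.

Lemma lacunary_derive_summable (nu : R) (k : nat) :
  -1 < nu -> (k <= 4)%nat ->
  summable (fun n => besselProd_coeff nu n * INR (k * n + 1))
    (fun n => pred (k * n + 1)%nat) (3 / 2).
Proof.
  intros Hnu Hk.
  apply (ex_series_ext (fun n => Rabs (besselProd_coeff nu n)
     * (INR (k * n + 1) * (INR (k * n + 1)) ^ 2 * (3 / 2) ^ (k * n)))).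
  { intros n. rewrite Rabs_mult, (Rabs_pos_eq (INR _)) by apply pos_INR.
    replace (pred (k * n + 1)) with (k * n)%nat by lia. rewrite plus_INR. simpl; ring. }
  apply coeff_cubic_summable with k; auto. intros n.
  replace (k * n + 2)%nat with (S (k * n + 1)) by lia. rewrite (S_INR (k * n + 1)).
  assert (Hm := pos_INR (k * n + 1)).
  assert (Hp : 0 <= (3 / 2) ^ (k * n)) by (apply pow_le; lra).
  rewrite (pow_add _ (k * n) 1).
  set (x := INR (k * n + 1)) in *. set (p := (3 / 2) ^ (k * n)) in *.
  assert (Hx : 0 <= x * x ^ 2) by (apply Rmult_le_pos; nra).
  split; [apply Rmult_le_pos; nra|]. apply Rmult_le_compat; nra.
Qed.

Definition lacunary_derive (k : nat) (nu : R) : C -> C :=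
  powSum (fun n => besselProd_coeff nu n * INR (k * n + 1))
    (fun n => pred (k * n + 1)).

Definition lacunary_derive2 (k : nat) (nu : R) : C -> C :=
  powSum (fun n => besselProd_coeff nu n * INR (k * n + 1) * INR (pred (k * n + 1)))
    (fun n => pred (pred (k * n + 1))).

Lemma lacunary_is_derive (k : nat) (nu : R) (z : C) :
  -1 < nu -> (k <= 4)%nat -> Cmod z < 3 / 2 ->
  is_derive (K := C_AbsRing) (V := C_NormedModule)
    (lacunary k nu) z (lacunary_derive k nu z).
Proof.
  intros Hnu Hk Hz. apply powSum_is_derive with (r := 3 / 2); [lra| |exact Hz].
  now apply lacunary_summable.
Qed.

Lemma lacunary_C_derive (k : nat) (nu : R) (z : C) :
  -1 < nu -> (k <= 4)%nat -> Cmod z < 3 / 2 ->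
  C_derive (lacunary k nu) z = lacunary_derive k nu z.
Proof.
  intros Hnu Hk Hz. apply is_C_derive_unique. now apply lacunary_is_derive.
Qed.

Lemma lacunary_C_derive2 (k : nat) (nu : R) (z : C) :
  -1 < nu -> (k <= 4)%nat -> Cmod z < 3 / 2 ->
  C_derive (C_derive (lacunary k nu)) z = lacunary_derive2 k nu z.
Proof.
  intros Hnu Hk Hz. apply is_C_derive_unique.
  apply (is_derive_ext_loc (K := C_AbsRing) (V := C_NormedModule) (lacunary_derive k nu)).
  - assert (Hd : 0 < 3 / 2 - Cmod z) by lra.
    exists (mkposreal _ Hd). intros y Hy.
    change (Cmod (y - z)%C < 3 / 2 - Cmod z) in Hy.
    symmetry. apply lacunary_C_derive; auto.
    replace y with (z + (y - z))%C by ring.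
    apply Rle_lt_trans with (1 := Cmod_triangle _ _). lra.
  - apply powSum_is_derive with (r := 3 / 2); [lra| |exact Hz].
    now apply lacunary_derive_summable.
Qed.

(** * Power series near the point 1 of the closed disk *)

Lemma Cmod_sq_le_1 (z : C) : Cmod z <= 1 -> Re z ^ 2 + Im z ^ 2 <= 1.
Proof.
  intros Hz. rewrite <- Cmod2_alt. generalize (Cmod_ge_0 z); nra.
Qed.

Lemma Cpow_Cmod_le_1 (z : C) (n : nat) : Cmod z <= 1 -> Cmod (z ^ n)%C <= 1.
Proof.
  intros Hz. rewrite Cmod_pow, <- (pow1 n).
  apply pow_incr; split; [apply Cmod_ge_0 | exact Hz].
Qed.

Lemma Im_Cpow_bound (z : C) (n : nat) :
  Cmod z <= 1 -> Rabs (Im (z ^ n)%C) <= INR n * Rabs (Im z).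
Proof.
  intros Hz. induction n as [|n IH].
  - simpl. rewrite Rabs_R0. lra.
  - rewrite Cpow_S, S_INR.
    change (Im (z * z ^ n)%C) with (Re z * Im (z ^ n)%C + Im z * Re (z ^ n)%C).
    apply Rle_trans with (1 := Rabs_triang _ _). rewrite !Rabs_mult.
    assert (H1 := Rle_trans _ _ _ (re_le_Cmod z) Hz).
    assert (H2 := Rle_trans _ _ _ (re_le_Cmod (z ^ n)%C) (Cpow_Cmod_le_1 z n Hz)).
    generalize (Rabs_pos (Im z)) (Rabs_pos (Im (z ^ n)%C)); nra.
Qed.

(** With d_n = 1 - Re z^n, one has
    d_(n+1) = (1 - Re z) + Re z * d_n + Im z * Im z^n, where the last term is at
    most n (Im z)^2 <= 2 n (1 - Re z); the increments 2 n + 1 add up to n^2. *)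
Lemma Re_Cpow_bound (z : C) (n : nat) :
  Cmod z <= 1 -> 0 <= 1 - Re (z ^ n)%C <= INR n ^ 2 * (1 - Re z).
Proof.
  intros Hz.
  assert (Hle : forall u : C, Cmod u <= 1 -> Re u <= 1).
  { intros u Hu. apply Rle_trans with (2 := Hu).
    apply Rle_trans with (1 := Rle_abs _), re_le_Cmod. }
  split.
  - generalize (Hle _ (Cpow_Cmod_le_1 z n Hz)); lra.
  - induction n as [|n IH]; [simpl; lra|].
    rewrite Cpow_S, S_INR.
    change (Re (z * z ^ n)%C) with (Re z * Re (z ^ n)%C - Im z * Im (z ^ n)%C).
    assert (H1 := Hle _ Hz). assert (Hn := Hle _ (Cpow_Cmod_le_1 z n Hz)).
    assert (Hsq := Cmod_sq_le_1 z Hz).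
    assert (HI : Im z * Im (z ^ n)%C <= INR n * (2 * (1 - Re z))).
    { apply Rle_trans with (1 := Rle_abs _). rewrite Rabs_mult.
      assert (Hi := Im_Cpow_bound z n Hz).
      assert (Hy := Rabs_pos (Im z)).
      assert (Hyy : Rabs (Im z) * Rabs (Im z) <= 2 * (1 - Re z)).
      { rewrite <- Rabs_mult, Rabs_pos_eq by nra. nra. }
      generalize (pos_INR n); nra. }
    assert (HR : Re z * (1 - Re (z ^ n)%C) <= 1 - Re (z ^ n)%C) by nra.
    nra.
Qed.

Definition genFun (t : nat -> R) : C -> C := powSum t (fun n => n).

Lemma genFun_Re (t : nat -> R) (z : C) :
  Re (genFun t z) = Series (fun n => t n * Re (z ^ n)%C).
Proof.
  apply Series_ext; intros n. unfold Re, Im. simpl. ring.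
Qed.

Lemma genFun_Im (t : nat -> R) (z : C) :
  Im (genFun t z) = Series (fun n => t n * Im (z ^ n)%C).
Proof.
  apply Series_ext; intros n. unfold Re, Im. simpl. ring.
Qed.

Lemma Re_Cpow_abs (z : C) (n : nat) :
  Cmod z <= 1 -> Rabs (Re (z ^ S n)%C) <= INR (S n) ^ 2 * 1.
Proof.
  intros Hz.
  apply Rle_trans with (1 := re_le_Cmod _), Rle_trans with (1 := Cpow_Cmod_le_1 z _ Hz).
  apply le_INR_S_sq; lra.
Qed.

Lemma Im_Cpow_abs (z : C) (n : nat) :
  Cmod z <= 1 -> Rabs (Im (z ^ S n)%C) <= INR (S n) ^ 2 * Rabs (Im z).
Proof.
  intros Hz. apply Rle_trans with (1 := Im_Cpow_bound z (S n) Hz).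
  apply INR_S_le_sq, Rabs_pos.
Qed.

Lemma dominated_ex_Re (t : nat -> R) (z : C) :
  dominated t -> Cmod z <= 1 -> ex_series (fun n => t n * Re (z ^ n)%C).
Proof.
  intros Ht Hz. apply dominated_ex_series with 1; [exact Ht|].
  intros n; now apply Re_Cpow_abs.
Qed.

Lemma dominated_ex_Im (t : nat -> R) (z : C) :
  dominated t -> Cmod z <= 1 -> ex_series (fun n => t n * Im (z ^ n)%C).
Proof.
  intros Ht Hz. apply dominated_ex_series with (Rabs (Im z)); [exact Ht|].
  intros n; now apply Im_Cpow_abs.
Qed.

(** Moving from 1 to z inside the disk changes the real part like the linear
    term alone: this compares h(z) with h(1). *)
Lemma genFun_Re_near_1 (t : nat -> R) (z : C) :
  dominated t -> Cmod z <= 1 ->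
  Rabs (Series t - Re (genFun t z) - t 1%nat * (1 - Re z))
  <= Rabs (t 1%nat) * (1 - Re z) / 11.
Proof.
  intros Ht Hz. rewrite genFun_Re.
  rewrite <- Series_minus by (first [now apply dominated_ex_Re | now apply dominated_ex]).
  rewrite (Series_ext _ (fun n => t n * (1 - Re (z ^ n)%C))) by (intros n; ring).
  assert (H := dominated_lead_term t (fun n => 1 - Re (z ^ n)%C) (1 - Re z) Ht).
  cbv beta in H. replace (Re (z ^ 0)%C) with 1 in H by reflexivity.
  rewrite Cpow_1_r, Rminus_diag, Rmult_0_r, Rminus_0_r in H.
  apply H. intros n.
  destruct (Re_Cpow_bound z (S n) Hz) as [H0 H1].
  change (Rabs (1 - Re (z ^ S n)%C) <= INR (S n) ^ 2 * (1 - Re z)).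
  now rewrite Rabs_pos_eq.
Qed.

Lemma genFun_Im_lead (t : nat -> R) (z : C) :
  dominated t -> Cmod z <= 1 ->
  Rabs (Im (genFun t z) - t 1%nat * Im z) <= Rabs (t 1%nat) * Rabs (Im z) / 11.
Proof.
  intros Ht Hz. rewrite genFun_Im.
  assert (H := dominated_lead_term t (fun n => Im (z ^ n)%C) (Rabs (Im z)) Ht
                 (fun n => Im_Cpow_abs z n Hz)).
  cbv beta in H. replace (Im (z ^ 0)%C) with 0 in H by reflexivity.
  rewrite Cpow_1_r in H.
  now rewrite Rmult_0_r, Rminus_0_r in H.
Qed.

Lemma genFun_Re_lead (t : nat -> R) (z : C) :
  dominated t -> Cmod z <= 1 ->
  Rabs (Re (genFun t z) - t 0%nat - t 1%nat * Re z) <= Rabs (t 1%nat) / 11.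
Proof.
  intros Ht Hz. rewrite genFun_Re.
  assert (H := dominated_lead_term t (fun n => Re (z ^ n)%C) 1 Ht
                 (fun n => Re_Cpow_abs z n Hz)).
  cbv beta in H. replace (Re (z ^ 0)%C) with 1 in H by reflexivity.
  rewrite Cpow_1_r in H.
  now rewrite !Rmult_1_r in H.
Qed.

(** * The derivative and the convexity expression as power series *)

Definition derivCoeff (k : nat) (nu : R) (n : nat) : R :=
  besselProd_coeff nu n * deriv_weight k n.

(** The coefficients of z f'' + lam f' in the variable z^k; for lam = 0 they are
    those of z f''. *)
Definition convCoeff (k : nat) (lam nu : R) (n : nat) : R :=
  besselProd_coeff nu n * conv_weight k lam n.

(** The left-hand side of the equation of which the critical order is the root. *)
Definition convValue (k : nat) (lam nu : R) : R := Series (convCoeff k lam nu).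

Lemma derivCoeff_dominated (k : nat) (nu : R) : -1 < nu -> dominated (derivCoeff k nu).
Proof. intros Hnu. apply coeff_dominated; [exact Hnu | apply deriv_weight_slow]. Qed.

Lemma convCoeff_dominated (k : nat) (lam nu : R) :
  -1 < nu -> 0 <= lam -> dominated (convCoeff k lam nu).
Proof.
  intros Hnu Hl. apply coeff_dominated; [exact Hnu | now apply conv_weight_slow].
Qed.

Lemma derivCoeff_0 (k : nat) (nu : R) : derivCoeff k nu 0 = 1.
Proof.
  unfold derivCoeff, deriv_weight, affine_weight. rewrite coeff_0. simpl; ring.
Qed.

Lemma derivCoeff_1 (k : nat) (nu : R) :
  derivCoeff k nu 1 = besselProd_coeff nu 1 * (INR k + 1).
Proof.
  unfold derivCoeff, deriv_weight, affine_weight. simpl; ring.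
Qed.

Lemma derivCoeff_1_neg (k : nat) (nu : R) : -1 < nu -> derivCoeff k nu 1 < 0.
Proof.
  intros Hnu. rewrite derivCoeff_1.
  generalize (coeff_1_neg nu Hnu) (pos_INR k); nra.
Qed.

Lemma convCoeff_0 (k : nat) (lam nu : R) : convCoeff k lam nu 0 = lam.
Proof.
  unfold convCoeff, conv_weight, deriv_weight, affine_weight. rewrite coeff_0.
  simpl; ring.
Qed.

Lemma convCoeff_1 (k : nat) (lam nu : R) :
  convCoeff k lam nu 1 = derivCoeff k nu 1 * (INR k + lam).
Proof.
  unfold convCoeff, conv_weight, derivCoeff, affine_weight. simpl; ring.
Qed.

Lemma lacunary_derive_genFun (k : nat) (nu : R) (z : C) :
  lacunary_derive k nu z = genFun (derivCoeff k nu) (z ^ k)%C.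
Proof.
  apply CSeries_ext; intros n. rewrite <- Cpow_mult_r.
  replace (pred (k * n + 1)) with (k * n)%nat by lia.
  f_equal. unfold derivCoeff, deriv_weight, affine_weight.
  now rewrite plus_INR, mult_INR.
Qed.

Lemma lacunary_derive2_genFun (k : nat) (nu : R) (z : C) :
  -1 < nu -> (k <= 4)%nat -> Cmod z < 3 / 2 ->
  (z * lacunary_derive2 k nu z)%C = genFun (convCoeff k 0 nu) (z ^ k)%C.
Proof.
  intros Hnu Hk Hz. unfold lacunary_derive2, powSum.
  rewrite <- CSeries_scal.
  - apply CSeries_ext; intros n. rewrite <- Cpow_mult_r.
    replace (pred (k * n + 1)) with (k * n)%nat by lia.
    replace (besselProd_coeff nu n * INR (k * n + 1) * INR (k * n))
      with (convCoeff k 0 nu n)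
      by (unfold convCoeff, conv_weight, deriv_weight, affine_weight;
          rewrite plus_INR, mult_INR; simpl; ring).
    unfold convCoeff, conv_weight, affine_weight. rewrite <- mult_INR.
    destruct (k * n)%nat as [|j].
    + simpl INR. rewrite Rplus_0_r, !Rmult_0_r. ring.
    + rewrite Cpow_S. simpl pred. ring.
  - apply (powSum_ex_derive _ _ (3 / 2)); [lra| |lra].
    now apply lacunary_derive_summable.
Qed.

Lemma convCoeff_split (k : nat) (lam nu : R) (n : nat) :
  convCoeff k lam nu n = convCoeff k 0 nu n + lam * derivCoeff k nu n.
Proof.
  unfold convCoeff, conv_weight, derivCoeff, affine_weight. ring.
Qed.

Lemma genFun_conv_Re (k : nat) (lam nu : R) (z : C) :
  -1 < nu -> Cmod z <= 1 ->
  Re (genFun (convCoeff k lam nu) z)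
  = Re (genFun (convCoeff k 0 nu) z) + lam * Re (genFun (derivCoeff k nu) z).
Proof.
  intros Hnu Hz. rewrite !genFun_Re, <- Series_scal_l, <- Series_plus.
  - apply Series_ext; intros n. rewrite (convCoeff_split k lam). ring.
  - apply dominated_ex_Re; [|exact Hz]. apply convCoeff_dominated; lra.
  - apply (@ex_series_scal R_AbsRing R_NormedModule lam).
    apply dominated_ex_Re; [|exact Hz]. now apply derivCoeff_dominated.
Qed.

Lemma genFun_conv_Im (k : nat) (lam nu : R) (z : C) :
  -1 < nu -> Cmod z <= 1 ->
  Im (genFun (convCoeff k lam nu) z)
  = Im (genFun (convCoeff k 0 nu) z) + lam * Im (genFun (derivCoeff k nu) z).
Proof.
  intros Hnu Hz. rewrite !genFun_Im, <- Series_scal_l, <- Series_plus.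
  - apply Series_ext; intros n. rewrite (convCoeff_split k lam). ring.
  - apply dominated_ex_Im; [|exact Hz]. apply convCoeff_dominated; lra.
  - apply (@ex_series_scal R_AbsRing R_NormedModule lam).
    apply dominated_ex_Im; [|exact Hz]. now apply derivCoeff_dominated.
Qed.

Lemma genFun_real (t : nat -> R) (x : R) :
  genFun t (RtoC x) = RtoC (Series (fun n => t n * x ^ n)).
Proof.
  unfold genFun, powSum, CSeries, RtoC. f_equal.
  - apply Series_ext; intros n. fold (RtoC x). rewrite <- RtoC_pow. simpl; ring.
  - rewrite (Series_ext _ (fun _ => 0 * 0)), Series_scal_l; [ring|].
    intros n. fold (RtoC x). rewrite <- RtoC_pow. simpl; ring.
Qed.

Lemma genFun_1 (t : nat -> R) : genFun t 1 = RtoC (Series t).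
Proof.
  rewrite genFun_real. f_equal. apply Series_ext; intros n. rewrite pow1; ring.
Qed.

Lemma convexity_equation_iff (k : nat) (alpha nu : R) :
  -1 < nu -> (k <= 4)%nat ->
  convexity_equation alpha (lacunary k nu) <-> convValue k (1 - alpha) nu = 0.
Proof.
  intros Hnu Hk. unfold convexity_equation, convValue.
  assert (H1 : Cmod 1 < 3 / 2) by (rewrite Cmod_1; lra).
  rewrite lacunary_C_derive, lacunary_C_derive2 by assumption.
  assert (H2 := lacunary_derive2_genFun k nu 1 Hnu Hk H1).
  rewrite Cmult_1_l in H2. rewrite H2, lacunary_derive_genFun, Cpow_1_l, !genFun_1.
  rewrite (Series_ext _ _ (convCoeff_split k (1 - alpha) nu)).
  rewrite Series_plus, Series_scal_l.
  - rewrite <- RtoC_minus, <- RtoC_mult, <- RtoC_plus. split; intros H.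
    + now apply RtoC_inj in H.
    + now rewrite H.
  - apply dominated_ex, convCoeff_dominated; lra.
  - apply (@ex_series_scal R_AbsRing R_NormedModule (1 - alpha)).
    now apply dominated_ex, derivCoeff_dominated.
Qed.

(** * A nonnegative value at 1 gives convexity *)

(** The hypothesis is Re ((p + (1 - alpha) q) * conj q) > 0; in particular it
    makes q nonzero. *)
Lemma lt_Re_1_plus_div (alpha : R) (p q : C) :
  0 < (Re p + (1 - alpha) * Re q) * Re q + (Im p + (1 - alpha) * Im q) * Im q ->
  alpha < Re (1 + p / q)%C.
Proof.
  destruct p as [a b], q as [x y]. simpl. intros H.
  assert (Hq : 0 < x * x + y * y).
  { destruct (Req_dec x 0) as [->|Hx]; [|nra].
    destruct (Req_dec y 0) as [->|Hy]; [|nra]. lra. }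
  rewrite !Rmult_1_r.
  replace (1 + (a * (x / (x * x + y * y)) - b * (- y / (x * x + y * y))))
    with (alpha + ((a + (1 - alpha) * x) * x + (b + (1 - alpha) * y) * y)
                  / (x * x + y * y)) by (field; lra).
  generalize (Rdiv_lt_0_compat _ _ H Hq); lra.
Qed.

(** Both p and q lie within 1/11 of a negative multiple of y, so both have the
    sign of - y. *)
Lemma mult_same_sign (p q s u y : R) :
  s < 0 -> u < 0 ->
  Rabs (p - s * y) <= Rabs s * Rabs y / 11 -> Rabs (q - u * y) <= Rabs u * Rabs y / 11 ->
  0 <= p * q.
Proof.
  intros Hs Hu Hp Hq.
  rewrite (Rabs_left s) in Hp by exact Hs. rewrite (Rabs_left u) in Hq by exact Hu.
  apply Rabs_le_between in Hp, Hq.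
  destruct (Rle_dec 0 y) as [Hy|Hy].
  - rewrite (Rabs_pos_eq y) in * by exact Hy. assert (p <= 0) by nra.
    assert (q <= 0) by nra. nra.
  - rewrite (Rabs_left y) in * by lra. assert (0 <= p) by nra.
    assert (0 <= q) by nra. nra.
Qed.

(** A nonnegative value at 1 means lam >= (10/11) b (k + lam), where - b is the
    linear coefficient of f'. As lam <= 1 <= k, this gives b <= 11/20. *)
Lemma derivCoeff_1_bound (k : nat) (lam nu : R) :
  -1 < nu -> (1 <= k)%nat -> 0 < lam <= 1 -> 0 <= convValue k lam nu ->
  - (11 / 20) <= derivCoeff k nu 1.
Proof.
  intros Hnu Hk Hl HF.
  assert (H := dominated_Series _ (convCoeff_dominated k lam nu Hnu ltac:(lra))).
  assert (Hb := derivCoeff_1_neg k nu Hnu).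
  fold (convValue k lam nu) in H.
  rewrite convCoeff_0, convCoeff_1 in H. apply le_INR in Hk. simpl in Hk.
  rewrite (Rabs_left (_ * _)) in H by nra.
  apply Rabs_le_between in H. nra.
Qed.

Lemma deriv_Re_pos (k : nat) (nu : R) (z : C) :
  -1 < nu -> - (11 / 20) <= derivCoeff k nu 1 -> Cmod z <= 1 ->
  0 < Re (genFun (derivCoeff k nu) z).
Proof.
  intros Hnu Hb Hz.
  assert (H := genFun_Re_lead _ z (derivCoeff_dominated k nu Hnu) Hz).
  assert (Hn := derivCoeff_1_neg k nu Hnu).
  rewrite derivCoeff_0, (Rabs_left _ Hn) in H. apply Rabs_le_between in H.
  assert (Hx := Rle_trans _ _ _ (re_le_Cmod z) Hz). apply Rabs_le_between in Hx.
  nra.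
Qed.

Lemma in_disk_pow (k : nat) (z : C) :
  (1 <= k)%nat -> in_disk z -> Cmod (z ^ k)%C < 1.
Proof.
  intros Hk Hz. unfold in_disk in Hz. rewrite Cmod_pow.
  destruct k as [|k]; [lia|]. simpl.
  assert (H0 := Cmod_ge_0 z).
  assert (H1 : Cmod z ^ k <= 1) by (rewrite <- (pow1 k); apply pow_incr; lra).
  nra.
Qed.

Lemma convexity_on_disk (k : nat) (alpha nu : R) (z : C) :
  -1 < nu -> (1 <= k <= 4)%nat -> 0 <= alpha < 1 ->
  0 <= convValue k (1 - alpha) nu -> in_disk z ->
  alpha < Re (1 + z * C_derive (C_derive (lacunary k nu)) z
                  / C_derive (lacunary k nu) z)%C.
Proof.
  intros Hnu Hk Ha HF Hz.
  assert (Hz32 : Cmod z < 3 / 2) by (unfold in_disk in Hz; lra).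
  rewrite lacunary_C_derive, lacunary_C_derive2, lacunary_derive2_genFun,
    lacunary_derive_genFun by (auto; lia).
  assert (Hzk := in_disk_pow k z (proj1 Hk) Hz).
  set (u := (z ^ k)%C) in *.
  apply lt_Re_1_plus_div.
  rewrite <- genFun_conv_Re, <- genFun_conv_Im by (auto; lra).
  assert (Hb := derivCoeff_1_bound k (1 - alpha) nu Hnu (proj1 Hk) ltac:(lra) HF).
  assert (Hn := derivCoeff_1_neg k nu Hnu).
  assert (Hc : convCoeff k (1 - alpha) nu 1 < 0).
  { rewrite convCoeff_1. generalize (pos_INR k). nra. }
  assert (Hdc : dominated (convCoeff k (1 - alpha) nu))
    by (apply convCoeff_dominated; lra).
  assert (Hdd := derivCoeff_dominated k nu Hnu).
  assert (HRA := deriv_Re_pos k nu u Hnu Hb ltac:(lra)).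
  assert (HRh : 0 < Re (genFun (convCoeff k (1 - alpha) nu) u)).
  { assert (H := genFun_Re_near_1 _ u Hdc ltac:(lra)).
    fold (convValue k (1 - alpha) nu) in H.
    rewrite (Rabs_left _ Hc) in H. apply Rabs_le_between in H.
    assert (Hu : Re u < 1).
    { apply Rle_lt_trans with (2 := Hzk).
      apply Rle_trans with (1 := Rle_abs _), re_le_Cmod. }
    nra. }
  assert (HI := mult_same_sign _ _ _ _ (Im u) Hc Hn
    (genFun_Im_lead _ u Hdc ltac:(lra)) (genFun_Im_lead _ u Hdd ltac:(lra))).
  generalize (Rmult_lt_0_compat _ _ HRh HRA); lra.
Qed.

Lemma Cmod_pow_diff (z1 z2 : C) (m : nat) :
  Cmod z1 <= 1 -> Cmod z2 <= 1 ->
  Cmod (z1 ^ m - z2 ^ m)%C <= INR m * Cmod (z1 - z2)%C.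
Proof.
  intros H1 H2. induction m as [|m IH].
  - simpl. replace (1 - 1)%C with (RtoC 0) by ring. rewrite Cmod_0. lra.
  - rewrite !Cpow_S, S_INR.
    replace (z1 * z1 ^ m - z2 * z2 ^ m)%C
      with (z1 * (z1 ^ m - z2 ^ m) + (z1 - z2) * z2 ^ m)%C by ring.
    apply Rle_trans with (1 := Cmod_triangle _ _). rewrite !Cmod_mult.
    assert (Hp := Cpow_Cmod_le_1 z2 m H2).
    generalize (Cmod_ge_0 (z1 ^ m - z2 ^ m)%C) (Cmod_ge_0 (z1 - z2)%C)
      (Cmod_ge_0 z1) (Cmod_ge_0 (z2 ^ m)%C); nra.
Qed.

(** With u = z1 - z2, the real part of conj u * (f z1 - f z2) is |u|^2 up to the
    terms of index n >= 1. Each of these is at most |u|^2 times the modulus of the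
    coefficient of z^(k n) in f'; together they are at most
    (12/11) (11/20) |u|^2 < |u|^2. *)
Lemma lacunary_univalent (k : nat) (nu : R) :
  -1 < nu -> (k <= 4)%nat -> - (11 / 20) <= derivCoeff k nu 1 ->
  univalent_on_disk (lacunary k nu).
Proof.
  intros Hnu Hk Hb z1 z2 H1 H2 Heq. unfold in_disk in *.
  destruct (Req_dec (Cmod (z1 - z2)%C) 0) as [H0|H0].
  { apply Cmod_eq_0 in H0. replace z1 with ((z1 - z2) + z2)%C by ring.
    rewrite H0. ring. }
  exfalso. set (u := (z1 - z2)%C) in *.
  assert (Hu : 0 < Cmod u ^ 2) by (generalize (Cmod_ge_0 u); nra).
  set (e := fun n => Re (Cconj u * (z1 ^ (k * n + 1) - z2 ^ (k * n + 1)))%C).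
  assert (He : forall n, Rabs (e n) <= deriv_weight k n * Cmod u ^ 2).
  { intros n. unfold e. apply Rle_trans with (1 := re_le_Cmod _).
    rewrite Cmod_mult, Cmod_conj.
    replace (deriv_weight k n) with (INR (k * n + 1))
      by (unfold deriv_weight, affine_weight; rewrite plus_INR, mult_INR; reflexivity).
    generalize (Cmod_pow_diff z1 z2 (k * n + 1) ltac:(lra) ltac:(lra)) (Cmod_ge_0 u).
    fold u. nra. }
  assert (Hw : forall n, 0 < deriv_weight k n).
  { intros n. unfold deriv_weight, affine_weight.
    generalize (Rmult_le_pos _ _ (pos_INR k) (pos_INR n)); lra. }
  (* The terms c_n e_n are rewritten as the coefficients of f' times d_n, to which
     the domination applies. *)
  set (d := fun n => e n / deriv_weight k n).
  assert (Hd : forall n, Rabs (d n) <= Cmod u ^ 2).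
  { intros n. unfold d, Rdiv. rewrite Rabs_mult, Rabs_inv, (Rabs_pos_eq (deriv_weight k n))
      by (generalize (Hw n); lra).
    apply Rmult_le_reg_r with (1 := Hw n). rewrite Rmult_assoc, Rinv_l
      by (generalize (Hw n); lra).
    generalize (He n); lra. }
  assert (HL := dominated_lead_term _ d (Cmod u ^ 2) (derivCoeff_dominated k nu Hnu)).
  assert (HS : Series (fun n => derivCoeff k nu n * d n) = 0).
  { assert (Hz : Re (Cconj u * (lacunary k nu z1 - lacunary k nu z2))%C = 0).
    { rewrite Heq. unfold Cminus. rewrite Cplus_opp_r, Cmult_0_r. reflexivity. }
    rewrite <- Hz. unfold lacunary, powSum.
    assert (Hex : forall z, Cmod z < 1 ->
      ex_series (fun n => Cmod (besselProd_coeff nu n * z ^ (k * n + 1))%C)).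
    { intros z Hzz. apply (powSum_ex _ (fun n => (k * n + 1)%nat) (3 / 2)); [lra| |lra].
      now apply lacunary_summable. }
    rewrite <- CSeries_minus by auto.
    rewrite <- CSeries_scal.
    - apply Series_ext; intros n. unfold derivCoeff, d, e.
      replace (Cconj u * (besselProd_coeff nu n * z1 ^ (k * n + 1)
                - besselProd_coeff nu n * z2 ^ (k * n + 1)))%C
        with (besselProd_coeff nu n * (Cconj u * (z1 ^ (k * n + 1) - z2 ^ (k * n + 1))))%C
        by ring.
      set (q := (Cconj u * _)%C).
      replace (Re (besselProd_coeff nu n * q)%C) with (besselProd_coeff nu n * Re q)
        by (simpl; ring).
      field. generalize (Hw n); lra.
    - apply ex_series_Cmod_minus; auto. }
  rewrite HS in HL.
  assert (Hd0 : d 0%nat = Cmod u ^ 2).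
  { unfold d, e. rewrite Nat.mul_0_r. simpl (0 + 1)%nat. rewrite !Cpow_1_r. fold u.
    rewrite Cmult_comm, <- Cmod2_conj.
    unfold deriv_weight, affine_weight. simpl. field. }
  rewrite derivCoeff_0, Hd0 in HL.
  assert (Hn := derivCoeff_1_neg k nu Hnu).
  rewrite (Rabs_left _ Hn) in HL.
  lapply HL; [clear HL; intros HL|].
  - apply Rabs_le_between in HL. assert (Hd1 := Hd 1%nat). apply Rabs_le_between in Hd1.
    nra.
  - intros n. apply Rle_trans with (1 := Hd (S n)). apply le_INR_S_sq; lra.
Qed.

Lemma lacunary_at_0 (k : nat) (nu : R) : lacunary k nu 0 = 0%C.
Proof.
  unfold lacunary, powSum. rewrite (CSeries_ext _ (fun _ => RtoC 0)).
  - unfold CSeries. simpl. rewrite (Series_ext _ (fun _ => 0 * 0)) by (intros; ring).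
    rewrite Series_scal_l, Rmult_0_l. reflexivity.
  - intros n. rewrite Cpow_add_r, Cpow_1_r. ring.
Qed.

Lemma lacunary_derive_at_0 (k : nat) (nu : R) :
  -1 < nu -> (1 <= k <= 4)%nat -> C_derive (lacunary k nu) 0 = 1%C.
Proof.
  intros Hnu Hk. rewrite lacunary_C_derive by (try rewrite Cmod_0; auto; try lia; lra).
  rewrite lacunary_derive_genFun.
  replace (RtoC 0 ^ k)%C with (RtoC 0)
    by (destruct k; [lia | rewrite Cpow_S; ring]).
  rewrite genFun_real. f_equal.
  rewrite dominated_Series_at_0 by now apply derivCoeff_dominated.
  apply derivCoeff_0.
Qed.

Lemma lacunary_convex (k : nat) (alpha nu : R) :
  -1 < nu -> (1 <= k <= 4)%nat -> 0 <= alpha < 1 ->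
  0 <= convValue k (1 - alpha) nu -> convex_of_order alpha (lacunary k nu).
Proof.
  intros Hnu Hk Ha HF.
  assert (Hb := derivCoeff_1_bound k (1 - alpha) nu Hnu (proj1 Hk) ltac:(lra) HF).
  split; [|split; [|split; [|split]]].
  - intros z Hz. exists (lacunary_derive k nu z).
    apply lacunary_is_derive; [exact Hnu | lia | unfold in_disk in Hz; lra].
  - apply lacunary_at_0.
  - now apply lacunary_derive_at_0.
  - apply lacunary_univalent; auto; lia.
  - intros z Hz. now apply convexity_on_disk.
Qed.

(** * Convexity forces a nonnegative value at 1 *)

Lemma pow_diff_bound (x y : R) (n : nat) :
  0 <= x <= 1 -> 0 <= y <= 1 -> Rabs (x ^ n - y ^ n) <= INR n * Rabs (x - y).
Proof.
  intros Hx Hy.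
  assert (H := Cmod_pow_diff (RtoC x) (RtoC y) n).
  rewrite <- !RtoC_pow, <- !RtoC_minus, !Cmod_R in H.
  apply H; rewrite Rabs_pos_eq; lra.
Qed.

Lemma dominated_lipschitz (t : nat -> R) (x y : R) :
  dominated t -> 0 <= x <= 1 -> 0 <= y <= 1 ->
  Rabs (Series (fun n => t n * x ^ n) - Series (fun n => t n * y ^ n))
  <= 2 * Rabs (t 1%nat) * Rabs (x - y).
Proof.
  intros Ht Hx Hy.
  assert (Hex : forall r, 0 <= r <= 1 -> ex_series (fun n => t n * r ^ n)).
  { intros r Hr. apply dominated_ex_series with 1; [exact Ht|]. intros n.
    rewrite Rabs_pos_eq by (apply pow_le; lra).
    assert (H : r ^ S n <= 1) by (rewrite <- (pow1 (S n)); apply pow_incr; lra).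
    apply Rle_trans with (1 := H). apply le_INR_S_sq; lra. }
  rewrite <- Series_minus by auto.
  rewrite (Series_ext _ (fun n => t n * (x ^ n - y ^ n))) by (intros; ring).
  assert (H := dominated_lead_term t (fun n => x ^ n - y ^ n) (Rabs (x - y)) Ht).
  lapply H; [clear H; intros H|].
  - simpl in H. replace (t 0%nat * (1 - 1)) with 0 in H by ring.
    rewrite !Rmult_1_r, Rminus_0_r in H.
    set (S0 := Series _) in *.
    replace S0 with ((S0 - t 1%nat * (x - y)) + t 1%nat * (x - y)) by ring.
    apply Rle_trans with (1 := Rabs_triang _ _). rewrite Rabs_mult.
    generalize (Rmult_le_pos _ _ (Rabs_pos (t 1%nat)) (Rabs_pos (x - y))). lra.
  - intros n. apply Rle_trans with (1 := pow_diff_bound x y (S n) Hx Hy).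
    apply INR_S_le_sq, Rabs_pos.
Qed.

(** The oscillation of [phi] controls that of [f], which makes [f] continuous on
    the segment. Composing with the projection onto the segment yields a function
    continuous on the whole line, as the intermediate value theorem requires. *)
Lemma IVT_controlled (f phi : R -> R) (a b : R) :
  a < b -> (forall x, a <= x <= b -> continuity_pt phi x) ->
  (forall x y, a <= x <= b -> a <= y <= b -> Rabs (f x - f y) <= Rabs (phi x - phi y)) ->
  f a < 0 -> 0 < f b -> exists x, a <= x <= b /\ f x = 0.
Proof.
  intros Hab Hphi Hf Ha Hb.
  set (c := fun x => Rmax a (Rmin b x)).
  assert (Hc : forall x, a <= c x <= b).
  { intros x; unfold c, Rmax, Rmin.
    destruct (Rle_dec b x), (Rle_dec a _); lra. }
  assert (Hfix : forall x, a <= x <= b -> c x = x).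
  { intros x Hx; unfold c. rewrite Rmin_right, Rmax_right; lra. }
  assert (Hlip : forall x y, Rabs (c x - c y) <= Rabs (x - y)).
  { intros x y; unfold c, Rmax, Rmin.
    destruct (Rle_dec b x), (Rle_dec b y);
    repeat match goal with |- context [Rle_dec ?p ?q] => destruct (Rle_dec p q) end;
      unfold Rabs; repeat destruct (Rcase_abs _); lra. }
  destruct (IVT (fun x => f (c x)) a b) as [x [Hx Hfx]].
  - intros x. apply continuity_pt_locally. intros eps.
    destruct (proj1 (continuity_pt_locally phi (c x)) (Hphi _ (Hc x)) eps) as [del Hdel].
    exists del. intros y Hy. apply Rle_lt_trans with (1 := Hf _ _ (Hc y) (Hc x)).
    apply Hdel. apply Rle_lt_trans with (1 := Hlip y x). exact Hy.
  - exact Hab.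
  - rewrite Hfix; lra.
  - rewrite Hfix; lra.
  - exists (c x). split; [apply Hc | exact Hfx].
Qed.

(** Where h(z^k) vanishes on the radius (0, 1), f' is positive and
    1 + z f'' / f' is exactly alpha, which strict convexity of order alpha
    excludes. *)
Lemma lacunary_convex_necessary (k : nat) (alpha nu : R) :
  -1 < nu -> (1 <= k <= 4)%nat -> 0 <= alpha < 1 ->
  convex_of_order alpha (lacunary k nu) -> 0 <= convValue k (1 - alpha) nu.
Proof.
  intros Hnu Hk Ha [_ [_ [_ [_ Hconv]]]].
  destruct (Rle_dec 0 (convValue k (1 - alpha) nu)) as [H|HF]; [exact H|exfalso].
  set (lam := 1 - alpha) in *. assert (Hl : 0 < lam) by (unfold lam; lra).
  set (t := convCoeff k lam nu).
  assert (Ht : dominated t) by (apply convCoeff_dominated; lra).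
  set (h := fun s => Series (fun n => t n * s ^ n)).
  assert (Hpow : forall r, 0 <= r <= 1 -> 0 <= r ^ k <= 1).
  { intros r Hr. split; [apply pow_le; lra|]. rewrite <- (pow1 k). apply pow_incr; lra. }
  assert (Hh0 : h 0 = lam).
  { unfold h. rewrite dominated_Series_at_0 by exact Ht. apply convCoeff_0. }
  assert (Hh1 : h 1 < 0).
  { replace (h 1) with (convValue k lam nu); [lra|].
    apply Series_ext; intros n. rewrite pow1. symmetry; apply Rmult_1_r. }
  (* The function is Lipschitz with the constant 2 k |t 1|. *)
  destruct (IVT_controlled (fun r => - h (r ^ k))
              (fun r => 2 * Rabs (t 1%nat) * INR k * r) 0 1) as [r [Hr Hhr]].
  - lra.
  - intros x _. apply continuity_pt_filterlim.
    apply (ex_derive_continuous (fun r => 2 * Rabs (t 1%nat) * INR k * r)).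
    auto_derive; trivial.
  - intros x y Hx Hy.
    replace (- h (x ^ k) - - h (y ^ k)) with (- (h (x ^ k) - h (y ^ k))) by ring.
    rewrite Rabs_Ropp.
    apply Rle_trans with (1 := dominated_lipschitz t _ _ Ht (Hpow x Hx) (Hpow y Hy)).
    rewrite <- Rmult_minus_distr_l, Rabs_mult, (Rabs_pos_eq (2 * _ * _)).
    + rewrite (Rmult_assoc _ (INR k)). apply Rmult_le_compat_l.
      * generalize (Rabs_pos (t 1%nat)); lra.
      * now apply pow_diff_bound.
    + apply Rmult_le_pos; [|apply pos_INR]. generalize (Rabs_pos (t 1%nat)); lra.
  - rewrite pow_i by lia. lra.
  - rewrite pow1. lra.
  - assert (Hhr0 : h (r ^ k) = 0) by lra.
    assert (Hr0 : r <> 0).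
    { intros ->. rewrite pow_i in Hhr0 by lia. lra. }
    assert (Hr1 : r <> 1).
    { intros ->. rewrite pow1 in Hhr0. lra. }
    assert (Hdisk : in_disk (RtoC r)).
    { unfold in_disk. rewrite Cmod_R, Rabs_pos_eq; lra. }
    specialize (Hconv _ Hdisk).
    assert (Hmod : Cmod (RtoC r) < 3 / 2) by (unfold in_disk in Hdisk; lra).
    rewrite lacunary_C_derive, lacunary_C_derive2, lacunary_derive2_genFun,
      lacunary_derive_genFun in Hconv by (auto; lia).
    rewrite <- RtoC_pow in Hconv.
    set (s := r ^ k) in *.
    assert (Hs : 0 < s <= 1).
    { split; [apply pow_lt; lra | now apply Hpow]. }
    assert (Hsm : Cmod (RtoC s) <= 1) by (rewrite Cmod_R, Rabs_pos_eq; lra).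
    assert (Hsplit := genFun_conv_Re k lam nu (RtoC s) Hnu Hsm).
    (* z f'' is negative on the radius, as its linear term is. *)
    assert (HB : Re (genFun (convCoeff k 0 nu) (RtoC s)) < 0).
    { assert (HD0 := convCoeff_dominated k 0 nu Hnu ltac:(lra)).
      assert (H := dominated_lead_term _ (fun n => s ^ n) s HD0).
      rewrite genFun_real. change (Re (RtoC ?x)) with x.
      lapply H; [clear H; intros H|].
      - cbv beta in H. rewrite convCoeff_0 in H. simpl pow in H at 2 3.
        rewrite Rmult_1_r in H.
        assert (Hneg : convCoeff k 0 nu 1 < 0).
        { rewrite convCoeff_1. destruct Hk as [Hk _]. apply le_INR in Hk. simpl in Hk.
          generalize (derivCoeff_1_neg k nu Hnu). nra. }
        rewrite (Rabs_left _ Hneg) in H. apply Rabs_le_between in H.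
        unfold Re, RtoC; simpl fst. nra.
      - intros n. rewrite Rabs_pos_eq by (apply pow_le; lra).
        apply Rle_trans with s; [|apply le_INR_S_sq; lra].
        simpl. assert (s ^ n <= 1) by (rewrite <- (pow1 n); apply pow_incr; lra). nra. }
    rewrite !genFun_real in *. fold t in Hsplit.
    change (Series (fun n => t n * s ^ n)) with (h s) in Hsplit.
    rewrite Hhr0 in Hsplit.
    set (B := Series (fun n => convCoeff k 0 nu n * s ^ n)) in *.
    set (A := Series (fun n => derivCoeff k nu n * s ^ n)) in *.
    change (0 = B + lam * A) in Hsplit. change (B < 0) in HB.
    assert (HA : A <> 0) by (intros H0; rewrite H0 in Hsplit; lra).
    rewrite <- RtoC_div, <- RtoC_plus in Hconv by exact HA.
    change (alpha < 1 + B / A) in Hconv.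
    replace (B / A) with (- lam) in Hconv; [unfold lam in Hconv; lra|].
    apply Rmult_eq_reg_r with A; [|exact HA]. unfold Rdiv.
    rewrite Rmult_assoc, Rinv_l by exact HA. lra.
Qed.

(** * Monotonicity in nu *)

Lemma shifted_ratio_le (a a' x : R) : a <= a' -> 0 <= x -> (a' + x) * a <= (a + x) * a'.
Proof. intros; nra. Qed.

(** Each factor (nu + 1 + x) / (nu' + 1 + x) of the quotient is at most 1 and
    increases with x. *)
Lemma coeff_ratio_quotient (nu nu' : R) (n : nat) :
  -1 < nu -> nu < nu' ->
  coeff_ratio nu 0 / coeff_ratio nu' 0 <= coeff_ratio nu n / coeff_ratio nu' n <= 1.
Proof.
  intros Hnu Hlt.
  assert (H0 := coeff_ratio_pos nu' 0 ltac:(lra)).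
  assert (Hn := coeff_ratio_pos nu' n ltac:(lra)).
  assert (Hx := pos_INR n). assert (Hx2 := pos_INR (2 * n)).
  assert (HxS := INR_S_ge_1 n).
  assert (Hfac : forall c, coeff_ratio c 0 = 16 * ((c + 1) * ((c + 1) * (c + 2))))
    by (intros c; unfold coeff_ratio; simpl; ring).
  split.
  - apply Rmult_le_reg_r with (1 := H0). apply Rmult_le_reg_r with (1 := Hn).
    replace (coeff_ratio nu 0 / coeff_ratio nu' 0 * coeff_ratio nu' 0 * coeff_ratio nu' n)
      with (coeff_ratio nu' n * coeff_ratio nu 0) by (field; lra).
    replace (coeff_ratio nu n / coeff_ratio nu' n * coeff_ratio nu' 0 * coeff_ratio nu' n)
      with (coeff_ratio nu n * coeff_ratio nu' 0) by (field; lra).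
    rewrite !Hfac. unfold coeff_ratio. rewrite (S_INR (2 * n)).
    set (x := INR n) in *. set (y := INR (2 * n)) in *.
    set (a := nu + 1). set (a' := nu' + 1).
    assert (Haa : 0 < a < a') by (unfold a, a'; lra).
    replace (nu + 2) with (a + 1) by (unfold a; ring).
    replace (nu' + 2) with (a' + 1) by (unfold a'; ring).
    assert (H1 := shifted_ratio_le a a' x ltac:(lra) Hx).
    assert (H2 := shifted_ratio_le a a' y ltac:(lra) Hx2).
    assert (H3 := shifted_ratio_le (a + 1) (a' + 1) y ltac:(lra) Hx2).
    apply Rle_trans with (256 * INR (S n) *
      (((a' + x) * a) * (((a' + y) * a) * ((a' + 1 + y) * (a + 1))))); [lra|].
    apply Rle_trans with (256 * INR (S n) *
      (((a + x) * a') * (((a + y) * a') * ((a + 1 + y) * (a' + 1))))); [|lra].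
    apply Rmult_le_compat_l; [lra|].
    assert (0 <= (a' + y) * a) by (apply Rmult_le_pos; lra).
    assert (0 <= (a' + 1 + y) * (a + 1)) by (apply Rmult_le_pos; lra).
    apply Rmult_le_compat; try exact H1.
    + apply Rmult_le_pos; lra.
    + now apply Rmult_le_pos.
    + now apply Rmult_le_compat.
  - apply Rmult_le_reg_r with (1 := Hn). unfold Rdiv.
    rewrite Rmult_assoc, Rinv_l, Rmult_1_r, Rmult_1_l by lra.
    unfold coeff_ratio. rewrite (S_INR (2 * n)).
    repeat (apply Rmult_le_compat; [| | |]); try lra;
      repeat apply Rmult_le_pos; lra.
Qed.

Definition coeff_quotient (nu nu' : R) (n : nat) : R :=
  besselProd_coeff nu' n / besselProd_coeff nu n.

Lemma coeff_quotient_S (nu nu' : R) (n : nat) :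
  -1 < nu -> nu < nu' ->
  coeff_quotient nu nu' (S n)
  = coeff_quotient nu nu' n * (coeff_ratio nu n / coeff_ratio nu' n).
Proof.
  intros Hnu Hlt. unfold coeff_quotient. rewrite !coeff_S by lra.
  assert (H1 := coeff_ratio_pos nu n Hnu).
  assert (H2 := coeff_ratio_pos nu' n ltac:(lra)).
  assert (H3 := coeff_neq_0 nu n Hnu).
  field. repeat split; lra.
Qed.

Lemma coeff_quotient_0 (nu nu' : R) : coeff_quotient nu nu' 0 = 1.
Proof. unfold coeff_quotient. rewrite !coeff_0. field. Qed.

(** The quotient at n + 1 is the quotient at n times a factor between
    q = [coeff_quotient nu nu' 1] and 1, so each step adds at most 1 - q to the
    relative variation. *)
Lemma coeff_quotient_bounds (nu nu' : R) (n : nat) :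
  -1 < nu -> nu < nu' ->
  0 <= coeff_quotient nu nu' n <= 1 /\
  1 - coeff_quotient nu nu' n <= INR n * (1 - coeff_quotient nu nu' 1).
Proof.
  intros Hnu Hlt.
  assert (Hq : coeff_quotient nu nu' 1 = coeff_ratio nu 0 / coeff_ratio nu' 0).
  { rewrite coeff_quotient_S, coeff_quotient_0 by assumption. ring. }
  assert (Hq0 : 0 < coeff_ratio nu 0 / coeff_ratio nu' 0)
    by (apply Rdiv_lt_0_compat; apply coeff_ratio_pos; lra).
  induction n as [|n [IH1 IH2]].
  - rewrite coeff_quotient_0. simpl. lra.
  - assert (Hs := coeff_ratio_quotient nu nu' n Hnu Hlt).
    rewrite Hq in IH2 |- *. rewrite coeff_quotient_S, S_INR by assumption.
    set (s := coeff_ratio nu n / coeff_ratio nu' n) in *.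
    set (q := coeff_ratio nu 0 / coeff_ratio nu' 0) in *.
    set (p := coeff_quotient nu nu' n) in *.
    split; [nra|].
    assert (p * (1 - s) <= 1 - q) by nra. lra.
Qed.

(** The difference is the series of the coefficients at [nu] times their relative
    variations, to which [dominated_lead_term] applies. *)
Lemma convValue_diff (k : nat) (lam nu nu' : R) :
  (1 <= k)%nat -> 0 <= lam -> -1 < nu -> nu < nu' ->
  convCoeff k lam nu 1 < convCoeff k lam nu' 1 /\
  Rabs (convValue k lam nu' - convValue k lam nu
        - (convCoeff k lam nu' 1 - convCoeff k lam nu 1))
  <= (convCoeff k lam nu' 1 - convCoeff k lam nu 1) / 11.
Proof.
  intros Hk Hl Hnu Hlt.
  set (d := fun n => 1 - coeff_quotient nu nu' n).
  assert (Hd : forall n, Rabs (d (S n)) <= INR (S n) ^ 2 * d 1%nat).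
  { intros n. destruct (coeff_quotient_bounds nu nu' (S n) Hnu Hlt) as [H1 H2].
    destruct (coeff_quotient_bounds nu nu' 1 Hnu Hlt) as [H3 _].
    unfold d. rewrite Rabs_pos_eq by lra.
    apply Rle_trans with (1 := H2). apply INR_S_le_sq. lra. }
  assert (Hdt : dominated (convCoeff k lam nu)) by now apply convCoeff_dominated.
  assert (Hdt' : dominated (convCoeff k lam nu')) by (apply convCoeff_dominated; lra).
  assert (H := dominated_lead_term _ d _ Hdt Hd).
  assert (Hterm : forall n, convCoeff k lam nu n * d n
                            = convCoeff k lam nu n - convCoeff k lam nu' n).
  { intros n. unfold convCoeff, d, coeff_quotient. field. now apply coeff_neq_0. }
  rewrite (Series_ext _ _ Hterm), Series_minus in H by now apply dominated_ex.
  fold (convValue k lam nu) (convValue k lam nu') in H.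
  assert (Hneg : convCoeff k lam nu 1 < 0).
  { rewrite convCoeff_1. apply le_INR in Hk. simpl in Hk.
    generalize (derivCoeff_1_neg k nu Hnu). nra. }
  rewrite (Rabs_left _ Hneg), Ropp_mult_distr_l_reverse, !Hterm, !convCoeff_0 in H.
  assert (Hd1 : 0 < d 1%nat).
  { unfold d, coeff_quotient. rewrite !coeff_1 by lra.
    assert (0 < 16 * (nu + 1) ^ 2 * (nu + 2)) by (apply Rmult_lt_0_compat; nra).
    assert (16 * (nu + 1) ^ 2 * (nu + 2) < 16 * (nu' + 1) ^ 2 * (nu' + 2)).
    { apply Rmult_le_0_lt_compat; nra. }
    set (X := 16 * (nu + 1) ^ 2 * (nu + 2)) in *.
    set (Y := 16 * (nu' + 1) ^ 2 * (nu' + 2)) in *.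
    replace (1 - - / Y / - / X) with ((Y - X) / Y) by (field; lra).
    apply Rdiv_lt_0_compat; lra. }
  assert (Ht1 := Hterm 1%nat). split; [nra|].
  apply Rabs_le_between in H. apply Rabs_le_between. lra.
Qed.

Lemma convValue_increasing (k : nat) (lam nu nu' : R) :
  (1 <= k)%nat -> 0 <= lam -> -1 < nu -> nu < nu' ->
  convValue k lam nu < convValue k lam nu'.
Proof.
  intros Hk Hl Hnu Hlt.
  destruct (convValue_diff k lam nu nu' Hk Hl Hnu Hlt) as [H1 H2].
  apply Rabs_le_between in H2. lra.
Qed.

(** Continuity in [nu] reduces to that of the linear coefficient, an explicit
    rational function, without any uniform convergence in [nu]. *)
Lemma convValue_modulus (k : nat) (lam nu nu' : R) :
  (1 <= k)%nat -> 0 <= lam -> -1 < nu -> -1 < nu' ->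
  Rabs (convValue k lam nu - convValue k lam nu')
  <= Rabs (2 * convCoeff k lam nu 1 - 2 * convCoeff k lam nu' 1).
Proof.
  intros Hk Hl.
  assert (Hlt : forall x y, -1 < x -> x < y ->
    Rabs (convValue k lam x - convValue k lam y)
    <= Rabs (2 * convCoeff k lam x 1 - 2 * convCoeff k lam y 1)).
  { intros x y Hx Hxy. destruct (convValue_diff k lam x y Hk Hl Hx Hxy) as [H1 H2].
    apply Rabs_le_between in H2. rewrite !Rabs_left; lra. }
  intros Hnu Hnu'. destruct (Rtotal_order nu nu') as [H|[->|H]].
  - now apply Hlt.
  - rewrite !Rminus_diag. lra.
  - rewrite Rabs_minus_sym, (Rabs_minus_sym (2 * _)). now apply Hlt.
Qed.

Lemma convCoeff_1_formula (k : nat) (lam nu : R) :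
  -1 < nu ->
  convCoeff k lam nu 1
  = - ((INR k + 1) * (INR k + lam)) / (16 * (nu + 1) ^ 2 * (nu + 2)).
Proof.
  intros Hnu. rewrite convCoeff_1, derivCoeff_1, coeff_1 by exact Hnu. field. lra.
Qed.

(** Near nu = -1 the linear coefficient is large and the value is negative; for
    nu large it is small and the value is close to lam. *)
Lemma convValue_root (k : nat) (lam : R) :
  (1 <= k <= 4)%nat -> 0 < lam <= 1 ->
  exists nu, -1 < nu /\ convValue k lam nu = 0.
Proof.
  intros Hk Hl.
  assert (HK : 1 <= INR k <= 4).
  { destruct Hk as [H1 H4]. apply le_INR in H1, H4. simpl in *. lra. }
  (* (k + 1) (k + lam) <= 25, so at nu = b the linear coefficient is at most
     25 / (16 (b + 1)) = lam / 16 in absolute value. *)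
  set (b := 25 / lam - 1).
  assert (Hb : 25 / lam >= 25).
  { apply Rle_ge. apply Rmult_le_reg_r with lam; [lra|]. field_simplify; lra. }
  set (phi := fun nu => 2 * (- ((INR k + 1) * (INR k + lam)) / (16 * (nu + 1) ^ 2 * (nu + 2)))).
  destruct (IVT_controlled (convValue k lam) phi (- (3 / 4)) b) as [x [Hx Hx0]].
  - unfold b; lra.
  - intros x Hx. apply continuity_pt_filterlim. apply (ex_derive_continuous phi).
    unfold phi. auto_derive.
    apply Rgt_not_eq. apply Rmult_lt_0_compat; [|lra]. nra.
  - intros x y Hx Hy. unfold phi. rewrite <- !convCoeff_1_formula by lra.
    apply convValue_modulus; lia || lra.
  - assert (H := dominated_Series _ (convCoeff_dominated k lam (- (3 / 4)) ltac:(lra) ltac:(lra))).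
    fold (convValue k lam (- (3 / 4))) in H.
    rewrite convCoeff_0, convCoeff_1_formula in H by lra.
    replace (- ((INR k + 1) * (INR k + lam)) / (16 * (- (3 / 4) + 1) ^ 2 * (- (3 / 4) + 2)))
      with (- (4 / 5 * ((INR k + 1) * (INR k + lam)))) in H by field.
    rewrite Rabs_Ropp, (Rabs_pos_eq (4 / 5 * _)) in H by nra.
    apply Rabs_le_between in H. nra.
  - assert (H := dominated_Series _ (convCoeff_dominated k lam b ltac:(unfold b; lra) ltac:(lra))).
    fold (convValue k lam b) in H.
    rewrite convCoeff_0, convCoeff_1_formula in H by (unfold b; lra).
    set (P := (INR k + 1) * (INR k + lam)) in *.
    assert (HP : 0 <= P <= 25) by (unfold P; nra).
    set (Q := 16 * (b + 1) ^ 2 * (b + 2)) in *.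
    assert (HQ : 16 * (25 / lam) <= Q).
    { unfold Q. replace (b + 1) with (25 / lam) by (unfold b; ring).
      replace (b + 2) with (25 / lam + 1) by (unfold b; ring).
      set (y := 25 / lam) in *.
      assert (y <= y ^ 2) by nra. nra. }
    assert (HPQ : 0 <= P / Q <= lam / 16).
    { assert (HQ0 : 0 < Q) by lra. split.
      - apply Rdiv_le_0_compat; lra.
      - apply Rmult_le_reg_r with (1 := HQ0).
        replace (P / Q * Q) with P by (field; lra).
        apply Rle_trans with (lam / 16 * (16 * (25 / lam))).
        + replace (lam / 16 * (16 * (25 / lam))) with 25 by (field; lra). lra.
        + apply Rmult_le_compat_l; lra. }
    replace (- P / Q) with (- (P / Q)) in H by (unfold Rdiv; ring).
    rewrite Rabs_Ropp, (Rabs_pos_eq (P / Q)) in H by lra.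
    apply Rabs_le_between in H. lra.
  - exists x. split; [lra | exact Hx0].
Qed.

(** * The critical value of nu *)

Lemma lacunary_critical_order (k : nat) (alpha : R) :
  (1 <= k <= 4)%nat -> 0 <= alpha < 1 ->
  exists nu_c : R,
    unique (fun nu => -1 < nu /\ convexity_equation alpha (lacunary k nu)) nu_c /\
    forall nu : R, -1 < nu ->
      (convex_of_order alpha (lacunary k nu) <-> nu >= nu_c).
Proof.
  intros Hk Ha.
  destruct (convValue_root k (1 - alpha) Hk ltac:(lra)) as [nu_c [Hc Hc0]].
  assert (Hmono := fun x y => convValue_increasing k (1 - alpha) x y (proj1 Hk) ltac:(lra)).
  exists nu_c. split; [split|].
  - split; [exact Hc|]. apply convexity_equation_iff; [exact Hc | lia | exact Hc0].
  - intros nu [Hnu Heq]. apply convexity_equation_iff in Heq; [|exact Hnu|lia].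
    destruct (Rtotal_order nu_c nu) as [H|[H|H]]; [|exact H|];
      apply Hmono in H; lra.
  - intros nu Hnu. split.
    + intros H. apply lacunary_convex_necessary in H; auto.
      destruct (Rle_lt_dec nu_c nu) as [Hle|Hlt]; [lra|].
      apply Hmono in Hlt; lra.
    + intros H. apply lacunary_convex; auto.
      destruct (Rle_lt_or_eq_dec nu_c nu ltac:(lra)) as [Hlt|Heq].
      * apply Hmono in Hlt; lra.
      * rewrite <- Heq. lra.
Qed.

Lemma w_lacunary (nu : R) : w nu = lacunary 1 nu.
Proof.
  apply functional_extensionality; intros z. apply CSeries_ext; intros n.
  now rewrite Nat.mul_1_l.
Qed.

Theorem theorem21 (alpha : R) (halpha : 0 <= alpha < 1) :
  (exists nu_c : R,
     unique (fun nu => -1 < nu /\ convexity_equation alpha (v nu)) nu_c /\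
     forall nu : R, -1 < nu ->
       (convex_of_order alpha (v nu) <-> nu >= nu_c)) /\
  (exists nu_c : R,
     unique (fun nu => -1 < nu /\ convexity_equation alpha (w nu)) nu_c /\
     forall nu : R, -1 < nu ->
       (convex_of_order alpha (w nu) <-> nu >= nu_c)).
Proof.
  (* [v nu] is convertible to [lacunary 4 nu]; for [w], the exponents n + 1 and
     1 * n + 1 are only provably equal. *)
  split.
  - exact (lacunary_critical_order 4 alpha ltac:(lia) halpha).
  - replace w with (lacunary 1)
      by (apply functional_extensionality; intros nu; now rewrite w_lacunary).
    exact (lacunary_critical_order 1 alpha ltac:(lia) halpha).
Qed.
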